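(* Let $p$ be a prime, $S$ a finite $p$-group, $\mathcal{F}$ a saturated fusion system on $S$, and $P\le S$ a fully $\mathcal{F}$-normalized subgroup with $C_S(P)\le P$. Then $C_{\Lambda_{\mathcal{F}}}(P)\cong\Lambda_{C_{\mathcal{F}}(P)}$ as $(C_S(P),C_S(P))$-bisets and $N_{\Lambda_{\mathcal{F}}}(P)\cong\Lambda_{N_{\mathcal{F}}(P)}$ as $(N_S(P),N_S(P))$-bisets. In other words, the centralizer (resp. normalizer) of $P$ in the minimal $\mathcal{F}$-characteristic biset is the minimal $C_{\mathcal{F}}(P)$-characteristic (resp. $N_{\mathcal{F}}(P)$-characteristic) biset.
   Context: Fusion systems and saturation are in the usual sense (Puig; Broto-Levi-Oliver). $\mathcal{F}(P,Q)$ denotes the set of $\mathcal{F}$-morphisms $P\to Q$ for $P,Q\le S$. $P$ is fully $\mathcal{F}$-normalized if $|N_S(P)|\ge|N_S(\varphi(P))|$ for all $\varphi\in\mathcal{F}(P,S)$. The normalizer fusion system $N_{\mathcal{F}}(P)$ is the fusion system on $N_S(P)$ whose morphisms $A\to B$ are the $\varphi\in\mathcal{F}(A,B)$ that extend to some $\widetilde\varphi\in\mathcal{F}(PA,PB)$ with $\widetilde\varphi(P)=P$; the centralizer fusion system $C_{\mathcal{F}}(P)$ is the fusion system on $C_S(P)$ whose morphisms $A\to B$ are the $\varphi\in\mathcal{F}(A,B)$ that extend to some $\widetilde\varphi\in\mathcal{F}(PA,PB)$ with $\widetilde\varphi|_P=\mathrm{id}_P$. Both are saturated when $P$ is fully $\mathcal{F}$-normalized.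 All bisets are finite. For a finite $p$-group $T$, a $(T,T)$-biset is a finite set $\Omega$ with a free left $T$-action and a free right $T$-action that commute; equivalently a left $(T\times T)$-set via $(b,a)\cdot\omega=b\cdot\omega\cdot a^{-1}$ on which $T\times 1$ and $1\times T$ act freely. For $Q\le T$ and an injective homomorphism $\psi\colon Q\to T$, write $(Q,\psi)=\{(\psi(a),a)\mid a\in Q\}\le T\times T$. Every point-stabilizer in a $(T,T)$-biset has this form. $\Omega^{(Q,\psi)}$ denotes the set of points fixed by $(Q,\psi)$. Let $\mathcal{G}$ be a fusion system on $T$. $\Omega$ is $\mathcal{G}$-generated if every point-stabilizer is of the form $(Q,\psi)$ with $\psi\in\mathcal{G}(Q,T)$. $\Omega$ is $\mathcal{G}$-stable if for every $Q\le T$, injective homomorphism $\psi\colon Q\to T$, and $\mathcal{G}$-isomorphisms $\eta_1\colon Q'\to Q$ and $\eta_2\colon\psi(Q)\to R$, one has $|\Omega^{(Q,\psi)}|=|\Omega^{(Q',\eta_2\psi\eta_1)}|$. $\Omega$ is $\mathcal{G}$-characteristic if it is $\mathcal{G}$-generated, $\mathcal{G}$-stable, and $|\Omega|/|T|\not\equiv 0\pmod p$. Every saturated $\mathcal{G}$ has a unique (up to isomorphism) minimal $\mathcal{G}$-characteristic biset $\Lambda_{\mathcal{G}}$, meaning one that is, up to isomorphism, contained in every $\mathcal{G}$-characteristic biset. For an $(S,S)$-biset $\Omega$, $N_\Omega(P)$ is the set of $\omega\in\Omega$ whose stabilizer $\mathrm{Stab}_{S\times S}(\omega)=(Q,\psi)$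 satisfies $P\le Q$ and $\psi(P)=P$, and $C_\Omega(P)$ is the subset of those with moreover $\psi|_P=\mathrm{id}_P$ (equivalently, $a\cdot\omega=\omega\cdot a$ for all $a\in P$). By restricting the actions, $N_\Omega(P)$ is an $(N_S(P),N_S(P))$-biset and $C_\Omega(P)$ is a $(C_S(P),C_S(P))$-biset. *)

(* Defs.v *)
From mathcomp Require Import all_boot all_fingroup pgroup.

Set Implicit Arguments.
Unset Strict Implicit.
Unset Printing Implicit Defensive.

Import GroupScope.

(* Fusion systems on a finite p-group S, with S and all its subgroups living  *)
(* in an ambient finGroupType gT. A morphism P -> Q is represented by a       *)
(* function f : gT -> gT, of which only the restriction to P is meaningful    *)
(* (see fusion_ext): F P Q f says that f|_P belongs to F(P, Q).               *)

Section FusionSystems.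

Variable gT : finGroupType.
Implicit Types (S P Q R A B : {group gT}) (f g : gT -> gT).

(* The fields state, in order: extensionality; F(P, Q) consists of injective  *)
(* homomorphisms between subgroups of S; Hom_S(P, Q) is contained in F(P, Q); *)
(* F is closed under composition; every morphism factors as an isomorphism of *)
(* F (fusion_im and fusion_inv) followed by an inclusion.                     *)
Record fusion_system S := FusionSystem {
  fusion_hom :> {group gT} -> {group gT} -> (gT -> gT) -> bool;
  fusion_ext : forall P Q f g,
    {in P, f =1 g} -> fusion_hom P Q f -> fusion_hom P Q g;
  fusion_mono : forall P Q f, fusion_hom P Q f ->
    [/\ P \subset S, Q \subset S, morphic P f, {in P &, injective f}
      & f @: P \subset Q];
  fusion_conj : forall P Q s, P \subset S -> Q \subset S -> s \in S ->
    P :^ s \subset Q -> fusion_hom P Q (conjg^~ s);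
  fusion_comp : forall P Q R f g,
    fusion_hom P Q f -> fusion_hom Q R g -> fusion_hom P R (g \o f);
  fusion_im : forall P Q R f,
    fusion_hom P Q f -> f @: P = R -> fusion_hom P R f;
  fusion_inv : forall P Q R f g,
    fusion_hom P Q f -> f @: P = R -> {in P, cancel f g} -> fusion_hom R P g
}.

Definition fusion_iso S (F : fusion_system S) P Q f : bool :=
  F P Q f && (f @: P == Q).

Definition fully_normalized S (F : fusion_system S) P : Prop :=
  P \subset S /\ forall f, F P S f -> #|'N_S(f @: P)| <= #|'N_S(P)|.

Definition fully_centralized S (F : fusion_system S) P : Prop :=
  P \subset S /\ forall f, F P S f -> #|'C_S(f @: P)| <= #|'C_S(P)|.

Definition Aut_fusion S (F : fusion_system S) P : {set {perm gT}} :=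
  [set a in Aut P | F P P a].

(* N_f = {g in N_S(P) | f c_g f^-1 in Aut_S(f(P))}. *)
Definition ext_domain S P f : {set gT} :=
  [set g in 'N_S(P) | [exists h in 'N_S(f @: P),
                        [forall x in P, f (x ^ g) == f x ^ h]]].

Lemma ext_domain_group_set S P f : group_set (ext_domain S P f).
Proof.
apply/group_setP; split.
  rewrite inE group1; apply/existsP; exists 1; rewrite group1 /=.
  by apply/forallP=> x; apply/implyP=> _; rewrite !conjg1.
move=> g1 g2 /setIdP[N1 /existsP[h1 /andP[Nh1 /forallP e1]]].
move=> /setIdP[N2 /existsP[h2 /andP[Nh2 /forallP e2]]].
rewrite inE groupM //; apply/existsP; exists (h1 * h2); rewrite groupM //=.
apply/forallP=> x; apply/implyP=> Px; rewrite !conjgM.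
have Pxg : x ^ g1 \in P by rewrite memJ_norm //; case/setIP: N1.
by rewrite (eqP (implyP (e2 _) Pxg)) (eqP (implyP (e1 _) Px)).
Qed.
Canonical ext_domain_group S P f := Group (ext_domain_group_set S P f).

(* Saturation in the sense of Broto-Levi-Oliver; conj_aut P @* 'N_S(P) is     *)
(* Aut_S(P).                                                                  *)
Definition saturated (p : nat) S (F : fusion_system S) : Prop :=
  (forall P, fully_normalized F P ->
     fully_centralized F P
     /\ p.-Sylow(Aut_fusion F P) (conj_aut P @* 'N_S(P)))
  /\ (forall P R f, F P S f -> f @: P = R -> fully_centralized F R ->
        exists2 g : gT -> gT, F (ext_domain_group S P f) S g & {in P, g =1 f}).

(* For A contained in N_S(P), the join P <*> A is the product P A.            *)
Definition normalizer_hom S (F : fusion_system S) P A B f : bool :=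
  [&& A \subset 'N_S(P), B \subset 'N_S(P), F A B f
    & [exists g : {ffun gT -> gT},
        [&& F (P <*> A)%G (P <*> B)%G g, [forall x in A, g x == f x]
          & g @: P == P]]].

Definition centralizer_hom S (F : fusion_system S) P A B f : bool :=
  [&& A \subset 'C_S(P), B \subset 'C_S(P), F A B f
    & [exists g : {ffun gT -> gT},
        [&& F (P <*> A)%G (P <*> B)%G g, [forall x in A, g x == f x]
          & [forall x in P, g x == x]]]].

Lemma normalizer_homP S (F : fusion_system S) P A B f :
  reflect ([/\ A \subset 'N_S(P), B \subset 'N_S(P), F A B f
    & exists g, [/\ F (P <*> A)%G (P <*> B)%G g, {in A, g =1 f}
                 & g @: P = P]])
          (normalizer_hom F P A B f).
Proof.
apply: (iffP and4P) => -[sA sB Ff].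
  case/existsP=> g /and3P[Fg /forall_inP eg /eqP gP].
  by split=> //; exists g; split=> // x /eg/eqP.
case=> g [Fg eg gP]; split=> //; apply/existsP; exists (finfun g).
have e: finfun g =1 g by move=> x; rewrite ffunE.
apply/and3P; split.
- by apply: fusion_ext Fg => x _; rewrite e.
- by apply/forall_inP=> x Ax; rewrite e eg.
- by rewrite (eq_imset _ e) gP.
Qed.

Lemma centralizer_homP S (F : fusion_system S) P A B f :
  reflect ([/\ A \subset 'C_S(P), B \subset 'C_S(P), F A B f
    & exists g, [/\ F (P <*> A)%G (P <*> B)%G g, {in A, g =1 f}
                 & {in P, g =1 id}]])
          (centralizer_hom F P A B f).
Proof.
apply: (iffP and4P) => -[sA sB Ff].
  case/existsP=> g /and3P[Fg /forall_inP eg /forall_inP gP].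
  by split=> //; exists g; split=> // x; [move/eg/eqP | move/gP/eqP].
case=> g [Fg eg gP]; split=> //; apply/existsP; exists (finfun g).
have e: finfun g =1 g by move=> x; rewrite ffunE.
apply/and3P; split.
- by apply: fusion_ext Fg => x _; rewrite e.
- by apply/forall_inP=> x Ax; rewrite e eg.
- by apply/forall_inP=> x Px; rewrite e gP.
Qed.

Lemma morphic_im_joing P A B f :
  morphic (P <*> A) f -> f @: P = P -> f @: A = B -> f @: (P <*> A) = P <*> B.
Proof.
move=> fM fP fA.
have e (X : {set gT}) : X \subset P <*> A -> morphm fM @* X = f @: X.
  by move=> sX; rewrite morphimEsub.
rewrite -(e _ (subxx _)) morphimY ?joing_subl ?joing_subr //.
by rewrite !e ?joing_subl ?joing_subr // fP fA.
Qed.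

Lemma can_inj_inv (D : {group gT}) f :
  {in D &, injective f} -> exists g : gT -> gT, {in D, cancel f g}.
Proof.
move=> fI; exists (fun y => odflt 1 [pick x in D | f x == y]) => x Dx /=.
case: pickP => [z /andP[Dz /eqP e] | /(_ x)]; last by rewrite Dx eqxx.
exact: fI.
Qed.

Section Local.

Variables (S : {group gT}) (F : fusion_system S) (P : {group gT}).
Hypothesis sPS : P \subset S.

Lemma normalizer_ext A B f g :
  {in A, f =1 g} -> normalizer_hom F P A B f -> normalizer_hom F P A B g.
Proof.
move=> e /normalizer_homP[sA sB Ff [h [Fh eh hP]]].
apply/normalizer_homP; split=> //; first exact: fusion_ext Ff.
by exists h; split=> // x Ax; rewrite eh ?e.
Qed.

Lemma centralizer_ext A B f g :
  {in A, f =1 g} -> centralizer_hom F P A B f -> centralizer_hom F P A B g.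
Proof.
move=> e /centralizer_homP[sA sB Ff [h [Fh eh hP]]].
apply/centralizer_homP; split=> //; first exact: fusion_ext Ff.
by exists h; split=> // x Ax; rewrite eh ?e.
Qed.

Lemma normalizer_mono A B f : normalizer_hom F P A B f ->
  [/\ A \subset 'N_S(P), B \subset 'N_S(P), morphic A f, {in A &, injective f}
    & f @: A \subset B].
Proof. by case/normalizer_homP=> sA sB /fusion_mono[]. Qed.

Lemma centralizer_mono A B f : centralizer_hom F P A B f ->
  [/\ A \subset 'C_S(P), B \subset 'C_S(P), morphic A f, {in A &, injective f}
    & f @: A \subset B].
Proof. by case/centralizer_homP=> sA sB /fusion_mono[]. Qed.

Lemma normalizer_conj A B s : A \subset 'N_S(P) -> B \subset 'N_S(P) ->
  s \in 'N_S(P) -> A :^ s \subset B -> normalizer_hom F P A B (conjg^~ s).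
Proof.
move=> sA sB /setIP[Ss Ns] sAB; apply/normalizer_homP.
have [sAS sBS] : A \subset S /\ B \subset S.
  by split; [apply: subset_trans sA _ | apply: subset_trans sB _];
     apply: subsetIl.
split=> //; first exact: fusion_conj.
exists (conjg^~ s); split=> //; last exact: (normP Ns).
apply: fusion_conj; rewrite ?join_subG ?sPS //=.
by rewrite conjYg (normP Ns) genS // setUS.
Qed.

Lemma centralizer_conj A B s : A \subset 'C_S(P) -> B \subset 'C_S(P) ->
  s \in 'C_S(P) -> A :^ s \subset B -> centralizer_hom F P A B (conjg^~ s).
Proof.
move=> sA sB /setIP[Ss Cs] sAB; apply/centralizer_homP.
have [sAS sBS] : A \subset S /\ B \subset S.
  by split; [apply: subset_trans sA _ | apply: subset_trans sB _];
     apply: subsetIl.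
have Ns : s \in 'N(P) by apply: (subsetP (cent_sub P)).
split=> //; first exact: fusion_conj.
exists (conjg^~ s); split=> //.
  apply: fusion_conj; rewrite ?join_subG ?sPS //=.
  by rewrite conjYg (normP Ns) genS // setUS.
by move=> x Px; rewrite /= conjgE -(centP Cs x Px) mulKg.
Qed.

Lemma normalizer_comp A B C f g : normalizer_hom F P A B f ->
  normalizer_hom F P B C g -> normalizer_hom F P A C (g \o f).
Proof.
case/normalizer_homP=> sA sB Ff [f' [Ff' ef fP]].
case/normalizer_homP=> _ sC Fg [g' [Fg' eg gP]].
apply/normalizer_homP; split=> //; first exact: fusion_comp Ff Fg.
exists (g' \o f'); split; first exact: fusion_comp Ff' Fg'.
  move=> x Ax; rewrite /= ef // eg //.
  by case/fusion_mono: Ff => _ _ _ _ /subsetP; apply; apply: imset_f.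
by rewrite imset_comp fP gP.
Qed.

Lemma centralizer_comp A B C f g : centralizer_hom F P A B f ->
  centralizer_hom F P B C g -> centralizer_hom F P A C (g \o f).
Proof.
case/centralizer_homP=> sA sB Ff [f' [Ff' ef fP]].
case/centralizer_homP=> _ sC Fg [g' [Fg' eg gP]].
apply/centralizer_homP; split=> //; first exact: fusion_comp Ff Fg.
exists (g' \o f'); split; first exact: fusion_comp Ff' Fg'.
  move=> x Ax; rewrite /= ef // eg //.
  by case/fusion_mono: Ff => _ _ _ _ /subsetP; apply; apply: imset_f.
by move=> x Px; rewrite /= fP ?gP.
Qed.

Lemma normalizer_im A B R f : normalizer_hom F P A B f -> f @: A = R ->
  normalizer_hom F P A R f.
Proof.
case/normalizer_homP=> sA sB Ff [g [Fg eg gP]] fA.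
have [_ _ _ _ sfAB] := fusion_mono Ff.
apply/normalizer_homP; split=> //.
- by rewrite -fA; apply: subset_trans sB.
- exact: fusion_im Ff fA.
- exists g; split=> //; apply: (fusion_im Fg).
  have [_ _ gM _ _] := fusion_mono Fg.
  by apply: morphic_im_joing => //; rewrite (eq_in_imset eg).
Qed.

Lemma centralizer_im A B R f : centralizer_hom F P A B f -> f @: A = R ->
  centralizer_hom F P A R f.
Proof.
case/centralizer_homP=> sA sB Ff [g [Fg eg gP]] fA.
have [_ _ _ _ sfAB] := fusion_mono Ff.
apply/centralizer_homP; split=> //.
- by rewrite -fA; apply: subset_trans sB.
- exact: fusion_im Ff fA.
- exists g; split=> //; apply: (fusion_im Fg).
  have [_ _ gM _ _] := fusion_mono Fg.
  apply: morphic_im_joing => //; last by rewrite (eq_in_imset eg).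
  by rewrite (eq_in_imset gP) imset_id.
Qed.

Lemma normalizer_inv A B R f g : normalizer_hom F P A B f -> f @: A = R ->
  {in A, cancel f g} -> normalizer_hom F P R A g.
Proof.
move=> NFf fA fK; have := normalizer_im NFf fA.
case/normalizer_homP=> sA sR Ff [f' [Ff' ef fP]].
have [_ _ fM fI _] := fusion_mono Ff'; have [g' f'K] := can_inj_inv fI.
have sP := joing_subl P A; have sAY := joing_subr P A.
have f'Y : f' @: (P <*> A) = P <*> R.
  by apply: morphic_im_joing => //; rewrite (eq_in_imset ef).
apply/normalizer_homP; split=> //; first exact: fusion_inv Ff fA fK.
exists g'; split; first exact: (fusion_inv Ff' f'Y f'K).
  move=> y; rewrite -fA => /imsetP[x Ax ->].
  by rewrite fK // -ef // f'K //; apply: (subsetP sAY).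
rewrite -{1}fP -imset_comp -[RHS]imset_id; apply: eq_in_imset => x Px.
by rewrite /= f'K //; apply: (subsetP sP).
Qed.

Lemma centralizer_inv A B R f g : centralizer_hom F P A B f -> f @: A = R ->
  {in A, cancel f g} -> centralizer_hom F P R A g.
Proof.
move=> CFf fA fK; have := centralizer_im CFf fA.
case/centralizer_homP=> sA sR Ff [f' [Ff' ef fP]].
have [_ _ fM fI _] := fusion_mono Ff'; have [g' f'K] := can_inj_inv fI.
have sP := joing_subl P A; have sAY := joing_subr P A.
have f'Y : f' @: (P <*> A) = P <*> R.
  apply: morphic_im_joing => //; last by rewrite (eq_in_imset ef).
  by rewrite (eq_in_imset fP) imset_id.
apply/centralizer_homP; split=> //; first exact: fusion_inv Ff fA fK.
exists g'; split; first exact: (fusion_inv Ff' f'Y f'K).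
  move=> y; rewrite -fA => /imsetP[x Ax ->].
  by rewrite fK // -ef // f'K //; apply: (subsetP sAY).
by move=> x Px; rewrite /= -{1}(fP x Px) f'K //; apply: (subsetP sP).
Qed.

Definition normalizer_fusion : fusion_system 'N_S(P)%G :=
  @FusionSystem 'N_S(P)%G (normalizer_hom F P) normalizer_ext normalizer_mono
    normalizer_conj normalizer_comp normalizer_im normalizer_inv.

Definition centralizer_fusion : fusion_system 'C_S(P)%G :=
  @FusionSystem 'C_S(P)%G (centralizer_hom F P) centralizer_ext centralizer_mono
    centralizer_conj centralizer_comp centralizer_im centralizer_inv.

End Local.

End FusionSystems.

(* A finite (T, T)-biset is encoded as a T x T-set. Actions of the library    *)
(* are right actions, so the biset structure and the action determine each    *)
(* other by  bact w (b, a) = b^-1 . w . a,  i.e. bact w u is the left action  *)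
(* of u^-1. Stabilisers and fixed points are the same for both.               *)

Section Bisets.

Variable gT : finGroupType.
Implicit Types (S T U P Q R : {group gT}) (f : gT -> gT).

Record biset T := Biset {
  bpt :> finType;
  bact : action (setX T T) bpt;
  bfree_l : forall w, 'C_(setX T 1)[w | bact] = 1;
  bfree_r : forall w, 'C_(setX 1 T)[w | bact] = 1
}.

Definition bstab T (X : biset T) (w : X) : {set gT * gT} :=
  'C_(setX T T)[w | bact X].

(* The subgroup (Q, f) of T x T.                                              *)
Definition twisted_diag (Q : {set gT}) f : {set gT * gT} :=
  [set (f a, a) | a in Q].

Definition bfix T (X : biset T) (Q : {set gT}) f : {set X} :=
  'Fix_(bact X)(twisted_diag Q f).

Definition biset_generated T (G : fusion_system T) (X : biset T) : Prop :=
  forall w : X, exists (Q : {group gT}) (f : gT -> gT),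
    G Q T f /\ bstab w = twisted_diag Q f.

Definition biset_stable T (G : fusion_system T) (X : biset T) : Prop :=
  forall (Q fQ Q' R : {group gT}) (f h1 h2 : gT -> gT),
    Q \subset T -> morphic Q f -> {in Q &, injective f} -> f @: Q \subset T ->
    fQ = f @: Q :> {set gT} ->
    fusion_iso G Q' Q h1 -> fusion_iso G fQ R h2 ->
    #|bfix X Q f| = #|bfix X Q' (h2 \o f \o h1)|.

(* As the actions are free, |T| divides |X|, so %/ is exact here.             *)
Definition characteristic_biset (p : nat) T (G : fusion_system T)
    (X : biset T) : Prop :=
  [/\ biset_generated G X, biset_stable G X & ~~ (p %| #|X| %/ #|T|)].

Definition bequivariant T (X Y : biset T) (h : X -> Y) : Prop :=
  forall w u, u \in setX T T -> h (bact X w u) = bact Y (h w) u.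

Definition biset_embeds T (X Y : biset T) : Prop :=
  exists2 h : X -> Y, bequivariant h & injective h.

Definition biset_isog T (X Y : biset T) : Prop :=
  exists2 h : X -> Y, bequivariant h & bijective h.

(* X is (a representative of the isomorphism class of) Lambda_G. *)
Definition minimal_characteristic_biset (p : nat) T (G : fusion_system T)
    (X : biset T) : Prop :=
  characteristic_biset p G X
  /\ forall Y : biset T, characteristic_biset p G Y -> biset_embeds X Y.

Section SubBiset.

Variables (T U : {group gT}) (X : biset T) (Y : {set X}).
Hypothesis nYU : [acts setX U U, on Y | bact X].

Let nYU' : setX U U \subset subact_dom (mem Y) (bact X).
Proof.
rewrite /subact_dom; suff -> : [set x | mem Y x] = Y by [].
by apply/setP=> x; rewrite inE.
Qed.

Definition sub_bact : action (setX U U) {w | w \in Y} :=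
  ((bact X)^? \ nYU')%act.

Lemma val_sub_bact w u : u \in setX U U ->
  val (sub_bact w u) = bact X (val w) u.
Proof. by move=> Uu; rewrite val_subact (subsetP nYU'). Qed.

Lemma sub_bstab (A : {set gT * gT}) (w : {w | w \in Y}) :
  A \subset setX U U -> 'C_A[w | sub_bact] \subset 'C_A[val w | bact X].
Proof.
move=> sAU; apply/subsetP=> u /setIP[Au /setIP[_]]; rewrite inE sub1set inE.
have uN := subsetP nYU' _ (subsetP sAU _ Au).
move=> /eqP/(congr1 val); rewrite val_subact uN => e.
rewrite inE Au /=; apply/setIP; split; first exact: astabs_dom uN.
by rewrite inE sub1set inE e.
Qed.

Hypothesis sUT : U \subset T.

Lemma sub_bfree_l w : 'C_(setX U 1)[w | sub_bact] = 1.
Proof.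
apply/eqP; rewrite eqEsubset sub1G andbT -(bfree_l (val w)).
apply: subset_trans (sub_bstab w _) _; first by rewrite setXS ?sub1G.
by rewrite setSI // setXS.
Qed.

Lemma sub_bfree_r w : 'C_(setX 1 U)[w | sub_bact] = 1.
Proof.
apply/eqP; rewrite eqEsubset sub1G andbT -(bfree_r (val w)).
apply: subset_trans (sub_bstab w _) _; first by rewrite setXS ?sub1G.
by rewrite setSI // setXS.
Qed.

Definition sub_biset : biset U := Biset sub_bfree_l sub_bfree_r.

End SubBiset.

Section Local.

Variables (S : {group gT}) (X : biset S) (P : {group gT}).

Definition biset_normset : {set X} :=
  [set w | [exists Q : {group gT}, exists f : {ffun gT -> gT},
     [&& bstab w == twisted_diag Q f, P \subset Q & f @: P == P]]].

Definition biset_centset : {set X} :=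
  [set w | [exists Q : {group gT}, exists f : {ffun gT -> gT},
     [&& bstab w == twisted_diag Q f, P \subset Q, f @: P == P
       & [forall a in P, f a == a]]]].

Lemma bstab_act (w : X) (Q : {group gT}) f b a : (b, a) \in setX S S ->
  bstab w = twisted_diag Q f ->
  bstab (bact X w (b, a)) = twisted_diag (Q :^ a) (fun x => f (x ^ a^-1) ^ b).
Proof.
move=> Su ew; have -> : bstab (bact X w (b, a)) = bstab w :^ (b, a).
  by rewrite /bstab conjIg (conjGid Su) astab1_act_in.
rewrite ew.
apply/setP=> -[y x]; rewrite mem_conjg; apply/imsetP/imsetP.
  case=> z Qz [e1 e2]; have {}e1 : y ^ b^-1 = f z := e1.
  have {}e2 : x ^ a^-1 = z := e2.
  exists x; first by rewrite mem_conjg e2.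
  by congr (_, _); rewrite /= e2 -e1 conjgKV.
case=> z; rewrite mem_conjg => Qz [-> ->]; exists (z ^ a^-1) => //.
by rewrite -[f _ in RHS](conjgK b).
Qed.

Lemma acts_biset_normset :
  [acts setX 'N_S(P) 'N_S(P), on biset_normset | bact X].
Proof.
have sN : setX 'N_S(P) 'N_S(P) \subset setX S S by rewrite setXS ?subsetIl.
apply/subsetP=> -[b a] Nu; have Su := subsetP sN _ Nu.
rewrite inE Su inE; apply/subsetP=> w /[!inE].
case/existsP=> Q /existsP[f /and3P[/eqP ew sPQ /eqP fP]].
have [/setIP[_ Nb] /setIP[_ Na]] := setXP Nu.
have NVa : a^-1 \in 'N(P) by rewrite groupV.
apply/existsP; exists (Q :^ a)%G; apply/existsP.
exists [ffun x => f (x ^ a^-1) ^ b]; rewrite (bstab_act Su ew).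
apply/and3P; split.
- by apply/eqP/eq_imset=> x; rewrite ffunE.
- by rewrite -(normP Na) conjSg.
apply/eqP; rewrite (eq_imset _ (ffunE _)).
rewrite (imset_comp (conjg^~ b \o f) (conjg^~ a^-1)) imset_comp.
by rewrite -/(P :^ a^-1) (normP NVa) fP; apply: (normP Nb).
Qed.

Lemma acts_biset_centset :
  [acts setX 'C_S(P) 'C_S(P), on biset_centset | bact X].
Proof.
have sC : setX 'C_S(P) 'C_S(P) \subset setX S S by rewrite setXS ?subsetIl.
apply/subsetP=> -[b a] Nu; have Su := subsetP sC _ Nu.
rewrite inE Su inE; apply/subsetP=> w /[!inE].
case/existsP=> Q /existsP[f /and4P[/eqP ew sPQ _ /forall_inP fP]].
have [/setIP[_ Cb] /setIP[_ Ca]] := setXP Nu.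
have Na := subsetP (cent_sub P) _ Ca.
have cJ c x : c \in 'C(P) -> x \in P -> x ^ c = x.
  by move=> Cc Px; rewrite conjgE -(centP Cc x Px) mulKg.
have fP' : {in P, forall x, f (x ^ a^-1) ^ b = x}.
  by move=> x Px; rewrite (cJ a^-1) ?groupV // (eqP (fP _ _)) ?cJ.
apply/existsP; exists (Q :^ a)%G; apply/existsP.
exists [ffun x => f (x ^ a^-1) ^ b]; rewrite (bstab_act Su ew).
apply/and4P; split.
- by apply/eqP/eq_imset=> x; rewrite ffunE.
- by rewrite -(normP Na) conjSg.
- apply/eqP; rewrite -[RHS]imset_id; apply: eq_in_imset => x Px.
  by rewrite ffunE fP'.
- by apply/forall_inP=> x Px; rewrite ffunE fP'.
Qed.

Definition biset_normalizer : biset 'N_S(P)%G :=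
  sub_biset acts_biset_normset (subsetIl S 'N(P)).

Definition biset_centralizer : biset 'C_S(P)%G :=
  sub_biset acts_biset_centset (subsetIl S 'C(P)).

End Local.

End Bisets.

(* Main.v *)
Require Import Defs.
From mathcomp Require Import all_boot all_fingroup all_solvable.
Import GroupScope.

Set Implicit Arguments.
Unset Strict Implicit.
Unset Printing Implicit Defensive.

(* Let Z = C_S(P). A biset is F-stable if the numbers of fixed points of the   *)
(* subgroups of S x S are constant on (F x F)-classes. Descending through the  *)
(* orders of the subgroups (Q, f), and starting from the empty biset, one adds *)
(* orbits (S x S) / (Q, f) until the counts agree on each class; a congruence  *)
(* for the class representative (Q, id) with Q fully normalized makes this     *)
(* possible. When Q is F-centric, an extension of f to a subgroup of N_S(Q) is *)
(* unique up to conjugation by C_S(f(Q)), so that before the class of (Q, f)   *)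
(* is treated, the fixed points of (Q, f) form a single free C_S(f(Q))-orbit   *)
(* or the empty set, and |C_S(Q)| can be taken as the common count. The result *)
(* is F-characteristic and contains Lambda, whence |Lambda^(P, id)| = |Z|.     *)
(* So C_Lambda(P) is one free Z-orbit, as it should be because C_F(P) is the   *)
(* trivial fusion system on Z, and Lambda^(P, a) is one free Z-orbit for each  *)
(* a in Aut_F(P), which gives |N_Lambda(P)| = |Aut_F(P)| |Z|. If Y is an       *)
(* N_F(P)-characteristic biset, then |Y^(P, a)| = k |Z| with k prime to p, and *)
(* the p-group N(P, a) has an orbit of length |Z| on Y^(P, a). By unique       *)
(* extension some point of this orbit has the same stabilizer as a point of    *)
(* N_Lambda(P) over a, and so N_Lambda(P) embeds in Y.                         *)

(** * Fusion systems and subgroups of T x T *)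

(** Everything rests on one count: for an F-centric [P] the minimal biset has exactly |C_S(P)|
    points fixed by (P, id) ([minimal_mark]). There are at least so many because C_S(P) x 1 acts
    freely on a nonempty set of fixed points, and at most so many because the minimal biset embeds
    in the one of [exists_staged], whose construction is carried by [mark_congr] and, through
    [fusion_unique_extension], by [staged_centric]. The hypotheses on [P] make it centric
    ([fully_normalized_fcentric]).

    Hence the points lying over a fixed automorphism of [P] form one free C_S(P)-orbit, and points
    of C_Lambda(P) or N_Lambda(P) with equal stabilizers lie in one orbit. By [biset_embedding],
    embedding these bisets in a characteristic biset Y then only requires that their stabilizers
    occur in Y; the condition prime to p forces this by a count modulo p|T|
    ([characteristic_normset], [normalizer_stab_exists]). Mutual embeddings of finite bisets are
    isomorphisms, whence uniqueness. *)

Section FusionBasics.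

Variables (gT : finGroupType) (T : {group gT}) (G : fusion_system T).
Implicit Types (A B C P Q R : {group gT}) (f g h : gT -> gT).

Lemma fusion_id A B f : A \subset B -> B \subset T -> {in A, f =1 id} -> G A B f.
Proof.
move=> sAB sBT fE; apply: (@fusion_ext _ _ G A B (conjg^~ 1)).
  by move=> x Ax; rewrite conjg1 fE.
by apply: fusion_conj; rewrite ?conjsg1 ?(subset_trans sAB).
Qed.

Lemma fusion_comp_cod A B C f g :
  G A B f -> G C T g -> f @: A \subset C -> G A T (g \o f).
Proof.
move=> Gf Gg sfC; have [_ _ fM fI _] := fusion_mono Gf.
have e : f @: A = (morphm fM @* A)%G by rewrite /= morphimEdom.
have [sCT _ _ _ _] := fusion_mono Gg.
have Gf' := fusion_im Gf e.
have Gi : G (morphm fM @* A)%G C id.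
  by apply: fusion_id => //; rewrite -e.
exact: (fusion_comp (fusion_comp Gf' Gi) Gg).
Qed.

Lemma fusion_res A A' B f : G A B f -> A' \subset A -> G A' B f.
Proof.
move=> Gf sA; have [sAT _ _ _ _] := fusion_mono Gf.
exact: (fusion_comp (fusion_id sA sAT (fun _ _ => erefl)) Gf).
Qed.

Lemma fusion_widen A B f : G A B f -> G A T f.
Proof.
move=> Gf; have [_ sBT _ _ _] := fusion_mono Gf.
exact: (fusion_comp Gf (fusion_id sBT (subxx T) (fun _ _ => erefl))).
Qed.

Lemma fusion_cod A B C f :
  G A B f -> f @: A \subset C -> C \subset T -> G A C f.
Proof.
move=> Gf sfC sCT; have [_ _ fM _ _] := fusion_mono Gf.
have e : f @: A = (morphm fM @* A)%G by rewrite /= morphimEdom.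
have Gf' := fusion_im Gf e; rewrite e in sfC.
exact: (fusion_comp Gf' (fusion_id sfC sCT (fun _ _ => erefl))).
Qed.

Lemma fusion_img A B f : G A B f -> {R : {group gT} | R = f @: A :> {set gT}}.
Proof.
case/fusion_mono=> _ _ fM _ _; exists (morphm fM @* A)%G.
by rewrite /= morphimEdom.
Qed.

Lemma fusion_invT A B R f : G A B f -> f @: A = R ->
  exists g, [/\ G R A g, {in A, cancel f g}, {in R, cancel g f} & g @: R = A].
Proof.
move=> Gf e; have [sAT _ _ fI _] := fusion_mono Gf.
have [g fK] := can_inj_inv fI; exists g; split=> //.
- exact: fusion_inv Gf e fK.
- by move=> y; rewrite -e => /imsetP[x Ax ->]; rewrite fK.
rewrite -e -imset_comp -[RHS]imset_id; apply: eq_in_imset => x Ax /=.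
exact: fK.
Qed.

Lemma fusion_card A B f : G A B f -> #|f @: A| = #|A|.
Proof. by case/fusion_mono=> _ _ _ fI _; rewrite card_in_imset. Qed.

Lemma fusionJ A B f x a :
  G A B f -> x \in A -> a \in A -> f (x ^ a) = f x ^ f a.
Proof.
case/fusion_mono=> _ _ fM _ _ Ax Aa.
by rewrite -(morphmE fM) morphJ.
Qed.

Lemma fusionM A B f x a :
  G A B f -> x \in A -> a \in A -> f (x * a) = f x * f a.
Proof.
by case/fusion_mono=> _ _ fM _ _ Ax Aa; rewrite -(morphmE fM) morphM.
Qed.

Lemma fusion_sub A B f x : G A B f -> x \in A -> f x \in B.
Proof.
by case/fusion_mono=> _ _ _ _ /subsetP sfB Ax; apply/sfB/imset_f.
Qed.

Lemma fusion_conjT A c : A \subset T -> c \in T -> G A T (conjg^~ c).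
Proof.
move=> sAT Tc; apply: fusion_conj => //.
by rewrite -(conjGid Tc) conjSg.
Qed.

End FusionBasics.

Section AutFusion.

Variables (gT : finGroupType) (T : {group gT}) (G : fusion_system T).
Variables (A : {group gT}).
Hypothesis sAT : A \subset T.

Lemma Aut_fusion_group_set : group_set (Aut_fusion G A).
Proof.
apply/group_setP; split.
  by rewrite inE group1 /=; apply: fusion_id => // x _; rewrite perm1.
move=> a b /setIdP[Aa Ga] /setIdP[Ab Gb]; rewrite inE groupM //=.
apply: fusion_ext (fusion_comp Ga Gb) => x Ax.
by rewrite /= permM.
Qed.
Definition Aut_fusion_group := Group Aut_fusion_group_set.

Lemma fusion_Aut f : G A A f -> exists2 a, a \in Aut_fusion G A & {in A, a =1 f}.
Proof.
move=> Gf; have [_ _ fM fI sf] := fusion_mono Gf.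
have inj : 'injm (morphm fM) by apply/injmP.
have im : morphm fM @* A = A.
  by apply/eqP; rewrite eqEcard morphimEdom sf card_in_imset ?leqnn.
exists (aut inj im); last by move=> x Ax; rewrite autE.
rewrite inE Aut_aut /=; apply: fusion_ext Gf => x Ax.
by rewrite autE.
Qed.

End AutFusion.

(** * Graphs of homomorphisms as subgroups of T x T *)

Section Pairs.

Variable gT : finGroupType.
Implicit Types (A B C P Q R : {group gT}) (f g h : gT -> gT).
Implicit Types (U V W : {group gT * gT}).

Definition pairf f2 f1 (u : gT * gT) : gT * gT := (f2 u.1, f1 u.2).

Lemma mem_setXP (B A : {set gT}) u :
  reflect (u.1 \in B /\ u.2 \in A) (u \in setX B A).
Proof. by rewrite inE; apply: andP. Qed.

Lemma mem_twisted_diag (Q : {set gT}) f u :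
  (u \in twisted_diag Q f) = (u.2 \in Q) && (u.1 == f u.2).
Proof.
apply/imsetP/andP=> [[a Qa ->] //= | [Q2 /eqP e]].
by exists u.2; rewrite // -e; case: u {Q2 e}.
Qed.

Lemma twisted_diag_group_set Q f : morphic Q f -> group_set (twisted_diag Q f).
Proof.
move=> fM; apply/group_setP; split=> [|[u1 u2] [v1 v2]].
  by rewrite mem_twisted_diag /= group1 -(morphmE fM) morph1 /=.
rewrite !mem_twisted_diag /= -!(morphmE fM) => /andP[Qu /eqP->] /andP[Qv /eqP->].
by rewrite groupM //= morphM.
Qed.

Lemma eq_twisted_diag (Q : {set gT}) f g :
  {in Q, f =1 g} -> twisted_diag Q f = twisted_diag Q g.
Proof. by move=> e; apply: eq_in_imset => x Qx; rewrite e. Qed.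

Lemma twisted_diag_inj (Q R : {set gT}) f g :
  twisted_diag Q f = twisted_diag R g -> Q = R /\ {in Q, f =1 g}.
Proof.
move=> e; have eQR : Q = R.
  apply/setP=> x; apply/idP/idP => [Qx | Rx].
    have: (f x, x) \in twisted_diag Q f by rewrite mem_twisted_diag Qx /=.
    by rewrite e mem_twisted_diag => /andP[].
  have: (g x, x) \in twisted_diag R g by rewrite mem_twisted_diag Rx /=.
  by rewrite -e mem_twisted_diag => /andP[].
split=> // x Qx.
have: (f x, x) \in twisted_diag Q f by rewrite mem_twisted_diag Qx /=.
by rewrite e mem_twisted_diag => /andP[_ /eqP].
Qed.

Lemma card_twisted_diag (Q : {set gT}) f : #|twisted_diag Q f| = #|Q|.
Proof. by rewrite card_imset // => x y []. Qed.

Lemma sub_twisted_diag (P Q : {set gT}) f g :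
  (twisted_diag P f \subset twisted_diag Q g) =
  (P \subset Q) && [forall x in P, f x == g x].
Proof.
apply/subsetP/andP => [H | [sPQ /forall_inP e] u].
  have H' x : x \in P -> (x \in Q) && (f x == g x).
    move=> Px; have: (f x, x) \in twisted_diag P f.
      by rewrite mem_twisted_diag Px /=.
    by move/H; rewrite mem_twisted_diag.
  by split; [apply/subsetP | apply/forall_inP] => x /H' /andP[].
rewrite !mem_twisted_diag => /andP[Pu /eqP->].
by rewrite (subsetP sPQ) //= e.
Qed.

Lemma sub_twisted_diagP U (Q : {set gT}) f : U \subset twisted_diag Q f ->
  exists2 R : {group gT}, R \subset Q & U = twisted_diag R f :> {set _}.
Proof.
move=> sU; have e : (snd @* U)%G = [set u.2 | u in U] :> {set gT}.
  by rewrite /= morphimE setTI.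
have H u : u \in U -> u.2 \in Q /\ u.1 = f u.2.
  by move/(subsetP sU); rewrite mem_twisted_diag => /andP[? /eqP].
exists (snd @* U)%G; rewrite e.
  by apply/subsetP=> _ /imsetP[u /H[? _] ->].
apply/setP=> u; rewrite mem_twisted_diag; apply/idP/andP => [Uu | []].
  by have [_ ->] := H u Uu; split; [apply: imset_f | ].
case/imsetP=> v Uv ev /eqP e1; have [_ ev1] := H v Uv.
suff -> : u = v by [].
by case: u v ev e1 ev1 {Uv} => [u1 u2] [v1 v2] /= -> -> ->.
Qed.

Lemma twisted_diag_sub (A B Q : {set gT}) f :
  (twisted_diag Q f \subset setX B A) = (Q \subset A) && (f @: Q \subset B).
Proof.
apply/subsetP/andP => [H | [sQA sfB] u].
  by split; apply/subsetP => x; [move=> Qx | case/imsetP=> {}x Qx ->];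
     have /setXP[] // : (f x, x) \in setX B A;
     apply: H; rewrite mem_twisted_diag Qx /=.
rewrite mem_twisted_diag inE => /andP[Qu /eqP->].
by rewrite (subsetP sQA) // (subsetP sfB) ?imset_f.
Qed.

Lemma pairf_twisted_diag (Q : {set gT}) f f1 g1 f2 :
  {in Q, cancel f1 g1} ->
  pairf f2 f1 @: twisted_diag Q f = twisted_diag (f1 @: Q) (f2 \o f \o g1).
Proof.
move=> K; rewrite /twisted_diag -!imset_comp; apply: eq_in_imset => x Qx /=.
by rewrite /pairf /= K.
Qed.

Section Pairm.
Variables (A B : {group gT}) (f2 f1 : gT -> gT).
Hypotheses (fM2 : morphic B f2) (fM1 : morphic A f1).

Lemma pairfM : {in setX B A &, {morph pairf f2 f1 : u v / u * v}}.
Proof.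
move=> [u1 u2] [v1 v2] /setXP[/= Bu Au] /setXP[/= Bv Av]; congr (_, _) => /=.
  by rewrite -(morphmE fM2) -morphM.
by rewrite -(morphmE fM1) -morphM.
Qed.
Definition pairm := Morphism pairfM.
End Pairm.

End Pairs.

Section FusionPairs.

Variables (gT : finGroupType) (T : {group gT}) (G : fusion_system T).
Implicit Types (A B C P Q R : {group gT}) (f g h : gT -> gT).
Implicit Types (U V W : {group gT * gT}).

(** The possible stabilizers of points of a [G]-generated biset, as a boolean predicate; finite
    functions suffice because [gT] is finite. *)
Definition ftwist (U : {set gT * gT}) : bool :=
  [exists Q : {group gT}, exists f : {ffun gT -> gT},
     G Q T f && (U == twisted_diag Q f)].

Lemma ftwistP (U : {set gT * gT}) :
  reflect (exists Q f, G Q T f /\ U = twisted_diag Q f) (ftwist U).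
Proof.
apply: (iffP existsP) => [[Q /existsP[f /andP[Gf /eqP->]]] | [Q [f [Gf ->]]]].
  by exists Q, f.
exists Q; apply/existsP; exists (finfun f).
have e : {in Q, f =1 finfun f} by move=> x _; rewrite ffunE.
by rewrite (fusion_ext e Gf) (eq_twisted_diag e) /=.
Qed.

(* Conjugacy of subgroups of T x T in the product fusion system G x G. *)
Definition fpair (U V : {set gT * gT}) : bool :=
  [exists A : {group gT}, exists B : {group gT},
   exists f1 : {ffun gT -> gT}, exists f2 : {ffun gT -> gT},
     [&& G A T f1, G B T f2, U \subset setX B A & V == pairf f2 f1 @: U]].

Lemma fpairP (U V : {set gT * gT}) :
  reflect (exists A B f1 f2, [/\ G A T f1, G B T f2, U \subset setX B A
             & V = pairf f2 f1 @: U]) (fpair U V).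
Proof.
apply: (iffP existsP) => [[A /existsP[B /existsP[f1 /existsP[f2]]]] | ].
  by case/and4P=> Gf1 Gf2 sU /eqP eV; exists A, B, f1, f2.
case=> A [B [f1 [f2 [Gf1 Gf2 sU ->]]]].
exists A; apply/existsP; exists B; apply/existsP; exists (finfun f1).
apply/existsP; exists (finfun f2).
have e f : f =1 finfun f by move=> x; rewrite ffunE.
rewrite (fusion_ext (in1W (e f1)) Gf1) (fusion_ext (in1W (e f2)) Gf2) sU /=.
by apply/eqP/eq_imset=> u; rewrite /pairf !ffunE.
Qed.

Lemma fpair_morph U (V : {set gT * gT}) A B f1 f2 :
  G A T f1 -> G B T f2 -> U \subset setX B A -> V = pairf f2 f1 @: U ->
  exists V' : {group gT * gT}, V = V'.
Proof.
move=> Gf1 Gf2 sU ->.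
have [_ _ fM1 _ _] := fusion_mono Gf1; have [_ _ fM2 _ _] := fusion_mono Gf2.
by exists (pairm fM2 fM1 @* U)%G; rewrite /= morphimEsub.
Qed.

Lemma pairf_inj A B f1 f2 : G A T f1 -> G B T f2 ->
  {in setX B A &, injective (pairf f2 f1)}.
Proof.
move=> Gf1 Gf2 [u1 u2] [v1 v2] /mem_setXP[/= Bu Au] /mem_setXP[/= Bv Av] [e2 e1].
have [_ _ _ fI1 _] := fusion_mono Gf1; have [_ _ _ fI2 _] := fusion_mono Gf2.
by congr (_, _); [apply: fI2 | apply: fI1].
Qed.

Lemma fpair_card (U V : {set gT * gT}) : fpair U V -> #|V| = #|U|.
Proof.
case/fpairP=> A [B [f1 [f2 [Gf1 Gf2 sU ->]]]]; rewrite card_in_imset //.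
by apply: sub_in2 (pairf_inj Gf1 Gf2) => u /(subsetP sU).
Qed.

Lemma fpair_subl (U V : {set gT * gT}) : fpair U V -> U \subset setX T T.
Proof.
case/fpairP=> A [B [f1 [f2 [Gf1 Gf2 sU _]]]].
apply: subset_trans sU _; apply: setXS.
  by case/fusion_mono: Gf2.
by case/fusion_mono: Gf1.
Qed.

Lemma fpair_sym (U V : {set gT * gT}) : fpair U V -> fpair V U.
Proof.
case/fpairP=> A [B [f1 [f2 [Gf1 Gf2 sU ->]]]].
have [R1 e1] := fusion_img Gf1; have [R2 e2] := fusion_img Gf2.
have [g1 [Gg1 K1 _ _]] := fusion_invT Gf1 (esym e1).
have [g2 [Gg2 K2 _ _]] := fusion_invT Gf2 (esym e2).
apply/fpairP; exists R1, R2, g1, g2; split.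
- exact: fusion_widen Gg1.
- exact: fusion_widen Gg2.
- apply/subsetP=> _ /imsetP[u /(subsetP sU)/mem_setXP[Bu Au] ->].
  by apply/mem_setXP; rewrite e1 e2; split; apply: imset_f.
rewrite -imset_comp -[LHS]imset_id; apply: eq_in_imset => -[u1 u2].
by move/(subsetP sU)/mem_setXP=> /= [Bu Au]; rewrite /pairf /= K1 ?K2.
Qed.

Lemma fpair_subr (U V : {set gT * gT}) : fpair U V -> V \subset setX T T.
Proof. by move/fpair_sym/fpair_subl. Qed.

Lemma fpair_trans U (V W : {set gT * gT}) : fpair U V -> fpair V W -> fpair U W.
Proof.
case/fpairP=> A [B [f1 [f2 [Gf1 Gf2 sU ->]]]].
case/fpairP=> A' [B' [g1 [g2 [Gg1 Gg2 sV ->]]]].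
(* [f1] need not map all of [A] into [A']; only the projections of [U] are safe domains for the
   composites. *)
have e2 : (snd @* U)%G = [set u.2 | u in U] :> {set gT}.
  by rewrite /= morphimE setTI.
have e1 : (fst @* U)%G = [set u.1 | u in U] :> {set gT}.
  by rewrite /= morphimE setTI.
apply/fpairP; exists (snd @* U)%G, (fst @* U)%G, (g1 \o f1), (g2 \o f2); split.
- apply: fusion_comp_cod Gg1 _.
    apply: (fusion_res Gf1); rewrite e2; apply/subsetP=> _ /imsetP[u Uu ->].
    by case/mem_setXP: (subsetP sU u Uu).
  rewrite e2; apply/subsetP=> _ /imsetP[_ /imsetP[u Uu ->] ->].
  by case/mem_setXP: (subsetP sV _ (imset_f (pairf f2 f1) Uu)).
- apply: fusion_comp_cod Gg2 _.
    apply: (fusion_res Gf2); rewrite e1; apply/subsetP=> _ /imsetP[u Uu ->].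
    by case/mem_setXP: (subsetP sU u Uu).
  rewrite e1; apply/subsetP=> _ /imsetP[_ /imsetP[u Uu ->] ->].
  by case/mem_setXP: (subsetP sV _ (imset_f (pairf f2 f1) Uu)).
- by apply/subsetP=> u Uu; apply/mem_setXP; rewrite e1 e2; split;
    apply: (imset_f _ Uu).
by rewrite -imset_comp.
Qed.

Lemma fpair_conj (U : {set gT * gT}) u :
  U \subset setX T T -> u \in setX T T -> fpair U (U :^ u).
Proof.
move=> sU /mem_setXP[T1 T2]; apply/fpairP.
exists T, T, (conjg^~ u.2), (conjg^~ u.1); split=> //; exact: fusion_conjT.
Qed.

Lemma fpair_ftwist (U V : {set gT * gT}) : fpair U V -> ftwist U -> ftwist V.
Proof.
case/fpairP=> A [B [f1 [f2 [Gf1 Gf2 sU ->]]]] /ftwistP[Q [f [Gf eU]]].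
move: sU; rewrite eU twisted_diag_sub => /andP[sQA sfQB].
have Gf1' := fusion_res Gf1 sQA.
have [R eR] := fusion_img Gf1'.
have [g [Gg K _ gR]] := fusion_invT Gf1' (esym eR).
apply/ftwistP; exists R, (f2 \o f \o g); split.
  apply: fusion_comp_cod Gf2 _; first exact: fusion_comp Gg Gf.
  by rewrite imset_comp gR.
by rewrite (pairf_twisted_diag _ _ K) -eR.
Qed.

Lemma ftwist_sub U (W : {set gT * gT}) : U \subset W -> ftwist W -> ftwist U.
Proof.
move=> sUW /ftwistP[Q [f [Gf eW]]]; rewrite eW in sUW.
have [R sRQ ->] := sub_twisted_diagP sUW.
by apply/ftwistP; exists R, f; split=> //; apply: fusion_res sRQ.
Qed.

(** Applying [f] to the right coordinate straightens its graph to the diagonal of its image, so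
    every class of twisted diagonals contains an untwisted one. *)
Lemma fpair_id Q R f : G Q T f -> f @: Q = R ->
  fpair (twisted_diag Q f) (twisted_diag R id).
Proof.
move=> Gf fQ; have [sQT _ _ _ sfT] := fusion_mono Gf.
apply/fpairP; exists Q, R, f, id; split=> //.
- by apply: fusion_id => //; rewrite -fQ.
- by rewrite twisted_diag_sub fQ !subxx.
by rewrite /twisted_diag -imset_comp -fQ -imset_comp.
Qed.

End FusionPairs.

(** * Numbers of fixed points and stability *)

Section Marks.

Variables (gT : finGroupType) (T : {group gT}).
Implicit Types (A B C P Q R : {group gT}) (f g h : gT -> gT).
Implicit Types (U V W : {group gT * gT}) (X Y : biset T).

Definition mark X (U : {set gT * gT}) : nat := #|'Fix_(bact X)(U)|.

Lemma mem_fix X (U : {set gT * gT}) (w : X) : U \subset setX T T ->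
  (w \in 'Fix_(bact X)(U)) = (U \subset bstab w).
Proof. by move=> sU; rewrite /bstab subsetI sU -sub_astab1_in. Qed.

Lemma bstab_sub X (w : X) : bstab w \subset setX T T.
Proof. exact: subsetIl. Qed.

Lemma mem_bstab X (w : X) u :
  (u \in bstab w) = (u \in setX T T) && (bact X w u == w).
Proof.
case Tu: (u \in setX T T); last first.
  by apply: contraFF Tu; apply: (subsetP (bstab_sub w)).
rewrite -sub1set -mem_fix ?sub1set //=.
exact/afix1P/eqP.
Qed.

Lemma bact_mul X (w : X) u v : u \in setX T T -> v \in setX T T ->
  bact X w (u * v) = bact X (bact X w u) v.
Proof. by move=> Tu Tv; rewrite actMin. Qed.

Lemma bact1 X (w : X) : bact X w 1 = w.
Proof. exact: act1. Qed.

Lemma bstab_conj X (w : X) u : u \in setX T T ->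
  bstab (bact X w u) = bstab w :^ u.
Proof. by move=> Tu; rewrite /bstab conjIg (conjGid Tu) astab1_act_in. Qed.

Lemma bstab_l1 X (w : X) t : (t, 1) \in bstab w -> t = 1.
Proof.
case/setIP=> /mem_setXP[Tt _] Ct.
have: (t, 1) \in 'C_(setX T 1)[w | bact X] by rewrite inE inE /= Tt set11.
by rewrite bfree_l => /set1P[].
Qed.

Lemma mark_conj X (U : {set gT * gT}) u : u \in setX T T -> U \subset setX T T ->
  mark X (U :^ u) = mark X U.
Proof.
move=> Tu sU.
have sUu : U :^ u \subset setX T T by rewrite -(conjGid Tu) conjSg.
rewrite /mark -[RHS](card_imset _ (act_inj (bact X) u)); congr #|pred_of_set _|.
apply/setP=> w; rewrite mem_fix //; apply/idP/imsetP => [sUw | [v]].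
  exists (bact X w u^-1); last by rewrite -bact_mul ?groupV // mulVg bact1.
  by rewrite mem_fix // bstab_conj ?groupV // -sub_conjg.
by rewrite mem_fix // => sUv ->; rewrite bstab_conj // conjSg.
Qed.

Section Stable.

Variable G : fusion_system T.

Definition fpair_stable X := forall U V, fpair G U V -> mark X U = mark X V.

Lemma generated_ftwist X (w : X) : biset_generated G X -> ftwist G (bstab w).
Proof. by move/(_ w)=> [Q [f ?]]; apply/ftwistP; exists Q, f. Qed.

Lemma ftwist_generated X : (forall w : X, ftwist G (bstab w)) ->
  biset_generated G X.
Proof. by move=> gX w; have /ftwistP[Q [f ?]] := gX w; exists Q, f. Qed.

Lemma fixed_ftwist X U : biset_generated G X -> U \subset setX T T ->
  0 < mark X U -> ftwist G U.
Proof.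
move=> gX sU /card_gt0P[w]; rewrite mem_fix // => sUw.
exact: ftwist_sub sUw (generated_ftwist w gX).
Qed.

(** [biset_stable] speaks of twisted diagonals only. In a generated biset a subgroup that fixes a
    point is the graph of a morphism of [G], so every class not covered has both numbers equal to
    0. *)
Lemma stable_fpair X :
  biset_generated G X -> biset_stable G X -> fpair_stable X.
Proof.
move=> gX sX U V pUV.
wlog mU : U V pUV / 0 < mark X U.
  move=> IH; have [mU | U0] := posnP (mark X U); last exact: IH.
  have [V0 | mV] := posnP (mark X V); first by rewrite mU V0.
  by rewrite (IH V U) // fpair_sym.
have /ftwistP[Q [f [Gf eU]]] := fixed_ftwist gX (fpair_subl pUV) mU.
case/fpairP: pUV => A [B [f1 [f2 [Gf1 Gf2 sU ->]]]].
move: sU; rewrite eU twisted_diag_sub => /andP[sQA sfQB].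
have Gf1' := fusion_res Gf1 sQA.
have [R eR] := fusion_img Gf1'.
have [g [Gg K _ gR]] := fusion_invT Gf1' (esym eR).
have [sQT _ fM fI sfT] := fusion_mono Gf.
have [fQ efQ] := fusion_img Gf.
have Gf2' : G fQ T f2 by apply: fusion_res Gf2 _; rewrite efQ.
have [R2 eR2] := fusion_img Gf2'.
rewrite (pairf_twisted_diag _ _ K) -eR.
apply: (sX Q fQ R R2 f g f2) => //.
  by rewrite /fusion_iso Gg gR eqxx.
by rewrite /fusion_iso (fusion_im Gf2' (esym eR2)) eR2 eqxx.
Qed.

Lemma fpair_stable_biset X : fpair_stable X -> biset_stable G X.
Proof.
move=> sX Q fQ Q' R f h1 h2 sQT fM fI sfT efQ /andP[Gh1 /eqP e1] /andP[Gh2 e2].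
have [g [Gg K K' gQ]] := fusion_invT Gh1 e1.
have tM := twisted_diag_group_set fM.
have p : fpair G (Group tM) (twisted_diag Q' (h2 \o f \o h1)).
  apply/fpairP; exists Q, fQ, g, h2; split=> //.
  - exact: fusion_widen Gg.
  - exact: fusion_widen Gh2.
  - by rewrite /= twisted_diag_sub efQ !subxx.
  by rewrite (pairf_twisted_diag _ _ K') gQ.
have p' := p; case/fpairP: p' => A [B [f1 [f2 [Gf1 Gf2 sU e]]]].
have [V eV] := fpair_morph Gf1 Gf2 sU e.
by have := sX (Group tM) V; rewrite -eV; apply.
Qed.

End Stable.

End Marks.

(** * Saturation *)

Section Saturation.

Variables (gT : finGroupType) (p : nat) (S : {group gT}) (F : fusion_system S).
Implicit Types (A B C P Q R : {group gT}) (f g h : gT -> gT).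

Lemma exists_fully_normalized Q : Q \subset S ->
  exists R f, [/\ F Q S f, f @: Q = R & fully_normalized F R].
Proof.
move=> sQS.
have F0 : F Q S (finfun id : {ffun gT -> gT}).
  by apply: fusion_id => // x _; rewrite ffunE.
have [f Ff maxf] := @arg_maxnP _ (finfun id : {ffun gT -> gT})
  (fun f : {ffun gT -> gT} => F Q S f) (fun f : {ffun gT -> gT} => #|'N_S(f @: Q)|) F0.
have [R eR] := fusion_img Ff; exists R, f; split=> //.
have [_ _ _ _ sfS] := fusion_mono Ff.
split=> [|g Fg]; first by rewrite eR.
have Fgf : F Q S (g \o f) by apply: fusion_comp_cod Ff Fg _; rewrite eR.
have e : finfun (g \o f) =1 g \o f by move=> x; rewrite ffunE.
have := maxf (finfun (g \o f)); rewrite (eq_imset _ e) imset_comp -eR; apply.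
by apply: fusion_ext Fgf => x _; rewrite e.
Qed.

Definition fcentric Q : Prop :=
  Q \subset S /\ forall f, F Q S f -> 'C_S(f @: Q) \subset f @: Q.

Lemma fcentric_cent Q : fcentric Q -> 'C_S(Q) \subset Q.
Proof.
case=> sQS /(_ id); rewrite imset_id; apply.
exact: fusion_id.
Qed.

Lemma fcentric_img Q R f : fcentric Q -> F Q S f -> f @: Q = R -> fcentric R.
Proof.
move=> [_ cQ] Ff fQ; have [_ _ _ _ sfS] := fusion_mono Ff.
split=> [|g Fg]; first by rewrite -fQ.
by rewrite -fQ -imset_comp; apply/cQ/(fusion_comp_cod Ff Fg); rewrite fQ.
Qed.

Lemma fcentricS Q R : fcentric Q -> Q \subset R -> R \subset S -> fcentric R.
Proof.
move=> [_ cQ] sQR sRS; split=> // f Ff.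
have sfQR : f @: Q \subset f @: R by apply: imsetS.
apply: (subset_trans _ (sfQR)); apply: subset_trans (cQ f (fusion_res Ff sQR)).
by rewrite setIS // centS.
Qed.

(** Both centralizers lie in the groups themselves, so they are the centers of [Q] and f(Q), and an
    isomorphism carries center to center. *)
Lemma fcentric_cent_img Q f : fcentric Q -> F Q S f ->
  'C_S(f @: Q) = f @: 'C_S(Q).
Proof.
move=> cQ Ff; have [sQS _ fM fI sfS] := fusion_mono Ff.
have sC := fcentric_cent cQ; have sCf := cQ.2 f Ff.
have -> : 'C_S(Q) = 'C_Q(Q).
  by apply/eqP; rewrite eqEsubset; apply/andP; split;
    [apply/subsetIP; split=> //; apply: subsetIr | apply: setSI].
have -> : 'C_S(f @: Q) = 'C_(f @: Q)(f @: Q).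
  by apply/eqP; rewrite eqEsubset; apply/andP; split;
    [apply/subsetIP; split=> //; apply: subsetIr | apply: setSI].
have inj : 'injm (morphm fM) by apply/injmP.
have e (X : {set gT}) : X \subset Q -> f @: X = morphm fM @* X.
  by move=> sX; rewrite morphimEsub.
by rewrite !e ?subsetIl // injm_subcent.
Qed.

Lemma fcentric_card_cent Q f : fcentric Q -> F Q S f ->
  #|'C_S(f @: Q)| = #|'C_S(Q)|.
Proof.
move=> cQ Ff; rewrite fcentric_cent_img //.
apply: (fusion_card (B := S)); apply: (fusion_res Ff).
exact: fcentric_cent.
Qed.

Lemma fcentric_fully_centralized Q : fcentric Q -> fully_centralized F Q.
Proof. by move=> cQ; split=> [|f Ff]; [case: cQ | rewrite fcentric_card_cent]. Qed.

Lemma mem_ext_domain Q f a :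
  reflect (a \in 'N_S(Q) /\ exists2 b, b \in 'N_S(f @: Q) &
             {in Q, forall x, f (x ^ a) = f x ^ b}) (a \in ext_domain S Q f).
Proof.
apply: (iffP setIdP) => -[Na H]; split=> //.
  by case/existsP: H => b /andP[Nb /forall_inP e]; exists b => // x /e/eqP.
case: H => b Nb e; apply/existsP; exists b; rewrite Nb.
by apply/forall_inP=> x /e->.
Qed.

Hypotheses (pS : p.-group S) (satF : saturated p F).

Lemma fcentric_extends Q f : fcentric Q -> F Q S f ->
  exists2 g, F (ext_domain_group S Q f) S g & {in Q, g =1 f}.
Proof.
move=> cQ Ff; have [R eR] := fusion_img Ff.
apply: (satF.2 Q R f Ff (esym eR)); apply: fcentric_fully_centralized.
exact: fcentric_img cQ Ff (esym eR).
Qed.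

(** [f] carries Aut_S(R) to a p-subgroup of Aut_F(Q). As Aut_S(Q) is Sylow there, some [b] in
    Aut_F(Q) moves it into Aut_S(Q); then the extension domain of [b \o f] is all of N_S(R), and the
    extension axiom applies because [Q] is fully centralized. *)
Lemma fusion_ext_norm Q R f : F R S f -> f @: R = Q -> fully_normalized F Q ->
  exists2 g, F 'N_S(R)%G S g & g @: R = Q.
Proof.
move=> Ff fR nQ; have [fcQ sylQ] := satF.1 Q nQ.
have [sRS _ fM fI sfS] := fusion_mono Ff.
have inj : 'injm (morphm fM) by apply/injmP.
have eQ : morphm fM @* R = Q by rewrite morphimEdom.
pose c := Aut_isom inj (subxx R).
have cE s : s \in 'N_S(R) -> {in R, forall x, c (conj_aut R s) (f x) = f (x ^ s)}.
  case/setIP=> Ss Ns x Rx.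
  by rewrite /c (Aut_isomE inj (subxx R)) ?Aut_aut // norm_conj_autE.
have sA : c @* (conj_aut R @* 'N_S(R)) \subset Aut_fusion F Q.
  apply/subsetP=> _ /morphimP[_ _ /morphimP[s Ns NSs ->] ->].
  rewrite inE -{1}eQ Aut_Aut_isom.
  have [g [Fg gK Kg _]] := fusion_invT Ff fR.
  have [_ NRs] := setIP NSs.
  have Fs : F R R (conjg^~ s).
    by apply: fusion_conj => //; rewrite ?(normP NRs) //; case/setIP: NSs.
  apply: (fusion_cod (B := S)); last 2 first.
  - apply/subsetP=> _ /imsetP[x Qx ->]; rewrite -eQ Aut_closed //=.
      exact: Aut_Aut_isom.
    by rewrite eQ.
  - by rewrite -fR.
  apply: fusion_ext (fusion_comp Fg (fusion_comp Fs Ff)) => x.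
  by rewrite -fR => /imsetP[y Ry ->]; rewrite /= gK // cE.
have pA : p.-group (c @* (conj_aut R @* 'N_S(R))).
  by rewrite !morphim_pgroup // (pgroupS (subsetIl _ _)).
have sQS : Q \subset S by rewrite -fR.
have [b Ab sAb] := Sylow_Jsub (G := Aut_fusion_group F sQS) sylQ sA pA.
move: Ab; rewrite inE => /andP[Ab Fb].
have Fbf : F R S (b \o f).
  by apply: fusion_comp_cod Ff (fusion_widen Fb) _; rewrite fR.
have bQ : b @: Q = Q.
  apply/eqP; rewrite eqEcard card_imset ?leqnn ?andbT; last exact: perm_inj.
  by case/fusion_mono: Fb.
have ebf : (b \o f) @: R = Q by rewrite imset_comp fR.
have [g Fg eg] := satF.2 R Q (b \o f) Fbf ebf fcQ.
exists g; last by rewrite (eq_in_imset eg).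
apply: (fusion_res Fg); apply/subsetP=> s Ns; apply/mem_ext_domain; split=> //.
have /(subsetP sAb)/morphimP[t _ Nt et] : c (conj_aut R s) ^ b \in
    (c @* (conj_aut R @* 'N_S(R))) :^ b.
  by rewrite memJ_conjg !mem_morphim ?Aut_aut //; case/setIP: Ns.
exists t; first by rewrite ebf.
move=> x Rx; have Qfx : f x \in Q by rewrite -fR imset_f.
have Qbfx : b (f x) \in Q by rewrite -bQ imset_f.
move/permP/(_ (b (f x))): et.
rewrite norm_conj_autE //; last by case/setIP: Nt.
by rewrite conjgE !permM permK cE.
Qed.

Lemma fusion_id_commutator Q R f x : F R S f -> {in Q, f =1 id} ->
  Q \subset R -> R \subset 'N_S(Q) -> x \in R -> x^-1 * f x \in 'C_S(Q).
Proof.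
move=> Ff fQ sQR sRN Rx; have [Sx Nx] := setIP (subsetP sRN x Rx).
rewrite inE groupM ?groupV ?(fusion_sub Ff) //=.
apply/centP=> q Qq; apply/commute_sym/commgP/conjg_fixP.
rewrite conjgM; set y := q ^ x^-1.
have Qy : y \in Q by rewrite memJ_norm ?groupV.
have eq_q : y ^ x = q by rewrite conjgKV.
rewrite -[RHS]fQ // -eq_q (fusionJ Ff) ?(subsetP sQR y) //.
by rewrite (fQ y).
Qed.

(* a has p-power order, so it is Aut_F(R)-conjugate to an element of Aut_S(R). *)
Lemma fusion_id_inner_norm Q R a : 'C_S(Q) \subset Q ->
    (forall b, b \in Aut_fusion F R -> 'C_S(b @: Q) \subset b @: Q) ->
    fully_normalized F R ->
    Q \subset R -> R \subset 'N_S(Q) -> a \in Aut_fusion F R ->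
    {in Q, a =1 id} ->
  exists2 z, z \in Q & {in R, forall x, a x = x ^ z}.
Proof.
move=> cQ cbQ nR sQR sRN Aa aQ; have [_ sylR] := satF.1 R nR.
have [AutR Fa] := setIdP Aa.
have sRS : R \subset S by case/fusion_mono: Fa.
have Ra x : x \in R -> a x \in R by exact: fusion_sub Fa.
have Qz x : x \in R -> x^-1 * a x \in Q.
  move=> Rx; apply: (subsetP cQ).
  exact: fusion_id_commutator (fusion_widen Fa) aQ sQR sRN Rx.
(* The factor [x^-1 * a x] lies in [Q], which [a] fixes pointwise, so iterating [a] takes powers of
   it. Hence the order of [a] divides |Q|. *)
have aXn n x : x \in R -> (a ^+ n) x = x * (x^-1 * a x) ^+ n.
  move=> Rx; elim: n => [|n IHn]; first by rewrite !expg0 perm1 mulg1.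
  rewrite expgSr permM IHn (fusionM Fa) // ?groupX ?(subsetP sQR) ?Qz //.
  by rewrite (aQ (_ ^+ n)) ?groupX ?Qz // expgS !mulgA mulgV mul1g.
have pa : p.-group <[a]>.
  have a1 : a ^+ #|Q| = 1.
    apply: (eq_Aut (A := R)) => [||x Rx]; rewrite ?groupX ?group1 //.
    by rewrite aXn // expg_cardG ?Qz // mulg1 perm1.
  apply: (pnat_dvd (n := #|Q|)); first by rewrite order_dvdn a1.
  by apply: pgroupS pS; apply: subset_trans sRS.
have sA : <[a]> \subset Aut_fusion_group F sRS by rewrite cycle_subG.
have [b Ab sAb] := Sylow_Jsub (G := Aut_fusion_group F sRS) sylR sA pa.
have /(subsetP sAb)/morphimP[s _ Ns es] : a ^ b \in <[a]> :^ b.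
  by rewrite memJ_conjg cycle_id.
have [_ Fb] := setIdP Ab; have [Ss NRs] := setIP Ns.
have esE x : x \in R -> b (a x) = b x ^ s.
  move=> Rx; move/permP/(_ (b x)): es.
  by rewrite norm_conj_autE ?(fusion_sub Fb) // conjgE !permM permK.
(* [s] centralizes b(Q) because [a] is trivial on [Q]; centricity puts it inside b(Q), and it can be
   pulled back to [Q]. *)
have /imsetP[q Qq eq_s] : s \in b @: Q.
  apply: (subsetP (cbQ b Ab)); rewrite inE Ss.
  apply/centP=> _ /imsetP[y Qy ->].
  by apply/commute_sym/commgP/conjg_fixP; rewrite -esE ?aQ ?(subsetP sQR).
exists q => // x Rx; apply: (@perm_inj _ b).
by rewrite esE // eq_s (fusionJ Fb) ?(subsetP sQR q).
Qed.

End Saturation.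

(** * Uniqueness of extensions of centric morphisms *)

Section UniqueExtension.

Variables (gT : finGroupType) (p : nat) (S : {group gT}) (F : fusion_system S).
Implicit Types (A B C P Q R : {group gT}) (f g h : gT -> gT).
Hypotheses (pS : p.-group S) (satF : saturated p F).

Lemma fusion_norm_img Q R f : F R S f -> Q \subset R -> R \subset 'N_S(Q) ->
  f @: R \subset 'N_S(f @: Q).
Proof.
move=> Ff sQR sRN; apply/subsetP=> _ /imsetP[x Rx ->].
rewrite inE (fusion_sub Ff) //=; have [Q' eQ'] := fusion_img (fusion_res Ff sQR).
rewrite -eQ'; apply/normP/eqP; rewrite eqEcard cardJg leqnn andbT eQ'.
apply/subsetP=> _ /imsetP[_ /imsetP[q Qq ->] ->].
rewrite -(fusionJ Ff) ?(subsetP sQR q) //; apply: imset_f.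
by rewrite memJ_norm //; case/setIP: (subsetP sRN x Rx).
Qed.

(** [f] preserves [R], as each [x^-1 * f x] lies in C_S(Q) <= Q. Conjugating [R] to a fully
    normalized subgroup reduces to [fusion_id_inner_norm], and the element brought back centralizes
    [Q] because [f] is trivial there. *)
Lemma fusion_id_inner Q R f : fcentric F Q ->
    Q \subset R -> R \subset 'N_S(Q) -> F R S f -> {in Q, f =1 id} ->
  exists2 z, z \in 'C_S(Q) & {in R, forall x, f x = x ^ z}.
Proof.
move=> cQ sQR sRN Ff fQ; have sC := fcentric_cent cQ.
have sRS : R \subset S by case/fusion_mono: Ff.
have FRR : F R R f.
  apply: (fusion_cod Ff) => //; apply/subsetP=> _ /imsetP[x Rx ->].
  rewrite -(groupMl _ (groupVr Rx)); apply/(subsetP sQR)/(subsetP sC).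
  exact: fusion_id_commutator Ff fQ sQR sRN Rx.
have [R' [g [Fg gR nR']]] := exists_fully_normalized F sRS.
have [h [Fh gK hK hR']] := fusion_invT Fg gR.
have [Q' eQ'] := fusion_img (fusion_res Fg sQR).
have FgR : F R R' g by apply: fusion_im Fg gR.
have [a Aa eqa] := fusion_Aut (fusion_comp Fh (fusion_comp FRR FgR)).
have cQ' := fcentric_img cQ (fusion_res Fg sQR) (esym eQ').
have sQ'R' : Q' \subset R' by rewrite eQ' -gR imsetS.
have [z Q'z ez] : exists2 z, z \in Q' & {in R', forall x, a x = x ^ z}.
  apply: (fusion_id_inner_norm pS satF) => //.
  - exact: fcentric_cent cQ'.
  - move=> b /setIdP[_ Fb]; apply: cQ'.2.
    exact: fusion_widen (fusion_res Fb sQ'R').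
  - by rewrite -gR eQ' fusion_norm_img.
  move=> x; rewrite eQ' => /imsetP[q Qq ->].
  by rewrite eqa ?(fusion_sub FgR) ?(subsetP sQR) //= gK ?fQ ?(subsetP sQR).
have /imsetP[q Qq eq_z] : z \in g @: Q by rewrite -eQ'.
have Rq := subsetP sQR q Qq.
have fE x : x \in R -> f x = x ^ q.
  move=> Rx; have := ez _ (fusion_sub FgR Rx).
  rewrite eqa ?(fusion_sub FgR) //= gK // eq_z -(fusionJ Fg) //.
  case/fusion_mono: Fg => _ _ _ gI _ /gI; apply; first exact: fusion_sub FRR _.
  by rewrite groupJ.
exists q => //; rewrite inE (subsetP sRS) //=; apply/centP=> x Qx.
by apply/commute_sym/commgP/conjg_fixP; rewrite -fE ?fQ // (subsetP sQR).
Qed.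

Lemma fusion_unique_extension Q R f g : fcentric F Q ->
    Q \subset R -> R \subset 'N_S(Q) -> F R S f -> F R S g -> {in Q, g =1 f} ->
  exists2 z, z \in 'C_S(f @: Q) & {in R, forall x, g x = f x ^ z}.
Proof.
move=> cQ sQR sRN Ff Fg efg.
have [R' eR'] := fusion_img Ff.
have [Q' eQ'] := fusion_img (fusion_res Ff sQR).
have [h [Fh fK hK hR']] := fusion_invT Ff (esym eR').
have cQ' := fcentric_img cQ (fusion_res Ff sQR) (esym eQ').
have [z Cz ez] : exists2 z, z \in 'C_S(Q') & {in R', forall x, (g \o h) x = x ^ z}.
  apply: fusion_id_inner => //.
  - by rewrite eR' eQ' imsetS.
  - by rewrite eQ' eR' fusion_norm_img.
  - exact: fusion_comp Fh Fg.
  move=> x; rewrite eQ' => /imsetP[q Qq ->] /=.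
  by rewrite fK ?efg // (subsetP sQR).
exists z; first by rewrite -eQ'.
move=> x Rx; rewrite -ez; last by rewrite eR' imset_f.
by rewrite /= fK.
Qed.

End UniqueExtension.

(** * Adding orbits to a biset *)

Lemma mem_subastab1 (aT : finGroupType) (D : {group aT}) (rT : finType)
    (to : action D rT) (A : {set aT}) x u : A \subset D ->
  (u \in 'C_A[x | to]) = (u \in A) && (to x u == x).
Proof.
move=> sAD; rewrite in_setI; case Au: (u \in A) => //=.
rewrite -sub1set sub_astab1_in ?sub1set ?(subsetP sAD) //.
exact/afix1P/eqP.
Qed.

Section SumAction.

Variables (aT : finGroupType) (D : {group aT}) (rT1 rT2 : finType).
Variables (to1 : action D rT1) (to2 : action D rT2).

Definition sum_to (w : rT1 + rT2) u : rT1 + rT2 :=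
  match w with inl x => inl (to1 x u) | inr y => inr (to2 y u) end.

Lemma sum_to_is_action : is_action D sum_to.
Proof.
split=> [u [x|y] [x'|y'] //= [] /act_inj -> // | [x|y] u v Du Dv /=].
  by rewrite actMin.
by rewrite actMin.
Qed.
Definition sum_act := Action sum_to_is_action.

Lemma card_afix_sum (U : {set aT}) :
  #|'Fix_sum_act(U)| = (#|'Fix_to1(U)| + #|'Fix_to2(U)|)%N.
Proof.
have -> : 'Fix_sum_act(U) = inl @: 'Fix_to1(U) :|: inr @: 'Fix_to2(U).
  apply/setP=> -[x|y]; rewrite in_setU; apply/afixP/idP => [H | H a Ua].
  - apply/orP; left; apply/imset_f/afixP=> a Ua.
    by have [] := H a Ua.
  - case/orP: H => /imsetP[z Fz //= [->]].
    by rewrite /= (afixP Fz).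
  - apply/orP; right; apply/imset_f/afixP=> a Ua.
    by have [] := H a Ua.
  case/orP: H => /imsetP[z Fz //= [->]].
  by rewrite /= (afixP Fz).
rewrite cardsU disjoint_setI0 ?cards0 ?subn0.
  by rewrite !card_imset //; [move=> ? ? [] | move=> ? ? []].
by apply/pred0P=> w /=; apply/negbTE/negP=> /andP[/imsetP[x _ ->] /imsetP[]].
Qed.

End SumAction.

Section CosetAction.

Variables (aT : finGroupType) (H D : {group aT}).

Lemma rcosets_subact_dom : H \subset subact_dom (mem (rcosets D H)) 'Rs.
Proof.
have -> : subact_dom (mem (rcosets D H)) 'Rs = 'N(rcosets D H | 'Rs).
  by rewrite /subact_dom; congr 'N(_ | _); apply/setP=> A; rewrite inE.
exact: actsRs_rcosets.
Qed.

Definition coset_act : action H {A | A \in rcosets D H} :=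
  ('Rs^? \ rcosets_subact_dom)%act.

Lemma val_coset_act A u : u \in H -> val (coset_act A u) = val A :* u.
Proof.
by move=> Hu; rewrite val_subact (subsetP rcosets_subact_dom) //= rcosetE.
Qed.

Lemma card_afix_coset (U : {set aT}) : U \subset H ->
  #|'Fix_coset_act(U)| = #|'Fix_(rcosets D H | 'Rs)(U)|.
Proof.
move=> sUH; rewrite -(card_imset _ val_inj); congr #|pred_of_set _|.
apply/setP=> A; apply/imsetP/setIP => [[a /afixP Fa ->] | [DA /afixP FA]].
  split; first exact: valP.
  apply/afixP=> u Uu; rewrite -[in RHS](Fa u Uu) val_coset_act ?(subsetP sUH) //=.
  by rewrite rcosetE.
exists (Sub A DA); last by rewrite SubK.
apply/afixP=> u Uu; apply: val_inj; rewrite val_coset_act ?(subsetP sUH) //=.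
by rewrite -rcosetE FA.
Qed.

Hypothesis sDH : D \subset H.

Lemma astab1_coset_act A : exists2 u, u \in H &
  'C_H[A | coset_act] = D :^ u.
Proof.
have /rcosetsP[u Hu eA] := valP A; exists u => //.
have sDuH : D :^ u \subset H by rewrite -(conjGid Hu) conjSg.
apply/setP=> v; rewrite mem_subastab1 //.
case Hv: (v \in H); last by apply/esym/(contraFF _ Hv)/(subsetP sDuH).
rewrite -val_eqE val_coset_act // -sub1set -sub_afixRs_norms eA /=.
by rewrite (sameP afix1P eqP) /= rcosetE.
Qed.

Lemma card_afix_coset_self : #|'Fix_coset_act(D)| = #|'N_H(D) : D|.
Proof. by rewrite card_afix_coset // afixRs_rcosets. Qed.

(** A coset D u is fixed by [U] only if U <= D^u, and then the orders force equality. *)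
Lemma card_afix_coset0 (U : {group aT}) : U \subset H -> #|D| <= #|U| ->
  U \notin [set (D :^ u)%G | u in H] -> #|'Fix_coset_act(U)| = 0.
Proof.
move=> sUH leDU notDU; rewrite card_afix_coset //; apply/eqP; rewrite cards_eq0.
apply: contraR notDU => /set0Pn[_ /setIP[/rcosetsP[u Hu ->]]].
rewrite sub_afixRs_norms => sUDu; apply/imsetP; exists u => //.
by apply/group_inj/eqP; rewrite eqEcard sUDu /= cardJg.
Qed.

End CosetAction.

Section BisetConstructions.

Variables (gT : finGroupType) (T : {group gT}).
Implicit Types (X : biset T) (D U V : {group gT * gT}).

Notation H := (setX T T).

Lemma empty_biset : exists X : biset T, forall w : X, False.
Proof.
have isact : is_action H (fun (w : void) (_ : gT * gT) => w) by split=> [u [] | []].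
pose a : action H void := Action isact.
exists (@Biset _ T void a (fun w => match w with end) (fun w => match w with end)).
by case.
Qed.

(** The disjoint union of [X] with the cosets of [D], whose stabilizers are the conjugates of [D].
    As T x 1 and 1 x T are normal in T x T, they meet these trivially too, so both actions stay
    free. *)
Lemma biset_add_orbit X D : D \subset H ->
    D :&: setX T 1 = 1 -> D :&: setX 1 T = 1 ->
  exists Y : biset T,
    (forall y : Y, (exists x : X, bstab y = bstab x)
        \/ exists2 u, u \in H & bstab y = D :^ u)
    /\ forall U, U \subset H -> mark Y U = (mark X U + #|'Fix_(coset_act H D)(U)|)%N.
Proof.
move=> sDH D1l D1r; set to := sum_act (bact X) (coset_act [group of H] D).
have stabl (x : X) (A : {set gT * gT}) : A \subset H ->
    'C_A[inl x | to] = 'C_A[x | bact X].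
  by move=> sAH; apply/setP=> u; rewrite !mem_subastab1.
have stabr B (A : {group gT * gT}) : A \subset H ->
    'C_A[inr B | to] = A :&: 'C_H[B | coset_act [group of H] D].
  move=> sAH; apply/setP=> u; rewrite mem_subastab1 // in_setI mem_subastab1 //.
  by case Au: (u \in A); rewrite //= (subsetP sAH).
have free (A : {group gT * gT}) B : A \subset H -> H \subset 'N(A) ->
    D :&: A = 1 -> 'C_A[inr B | to] = 1.
  move=> sAH nAH DA1; rewrite stabr //.
  have [u Hu ->] := astab1_coset_act sDH B.
  by rewrite setIC -(normP (subsetP nAH u Hu)) -conjIg DA1 conjs1g.
have sl : setX T 1 \subset H by rewrite setXS ?sub1G.
have sr : setX 1 T \subset H by rewrite setXS ?sub1G.
have nl : H \subset 'N(setX T 1).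
  apply/subsetP=> -[b a] /mem_setXP[/= Tb Ta]; rewrite inE.
  apply/subsetP=> _ /imsetP[[c d] /mem_setXP[/= Tc /set1P->] ->].
  have -> : (c, 1) ^ (b, a) = (c ^ b, 1 ^ a) by [].
  by apply/mem_setXP; rewrite /= conj1g groupJ ?group1.
have nr : H \subset 'N(setX 1 T).
  apply/subsetP=> -[b a] /mem_setXP[/= Tb Ta]; rewrite inE.
  apply/subsetP=> _ /imsetP[[c d] /mem_setXP[/= /set1P-> Td] ->].
  have -> : (1, d) ^ (b, a) = (1 ^ b, d ^ a) by [].
  by apply/mem_setXP; rewrite /= conj1g groupJ ?group1.
have fl w : 'C_(setX T 1)[w | to] = 1.
  case: w => [x|B]; first by rewrite stabl // bfree_l.
  exact: (free [group of setX T 1]).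
have fr w : 'C_(setX 1 T)[w | to] = 1.
  case: w => [x|B]; first by rewrite stabl // bfree_r.
  exact: (free [group of setX 1 T]).
exists (Biset fl fr); split=> [[x|B] | U sUH].
- by left; exists x; apply: stabl.
- right; have [u Hu eu] := astab1_coset_act sDH B; exists u => //.
  by rewrite -eu /bstab /= (stabr B [group of H]) // setIA setIid.
exact: card_afix_sum.
Qed.

Variable G : fusion_system T.

Lemma ftwist_free D : ftwist G D ->
  [/\ D \subset H, D :&: setX T 1 = 1 & D :&: setX 1 T = 1].
Proof.
case/ftwistP=> Q [f [Gf ->]]; have [sQT _ fM fI sfT] := fusion_mono Gf.
have f1 : f 1 = 1 by rewrite -(morphmE fM) morph1.
split; first by rewrite twisted_diag_sub sQT.
  apply/setP=> -[b a]; rewrite !inE mem_twisted_diag /=.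
  apply/idP/eqP => [/and3P[/andP[_ /eqP->] _ /eqP->] | [-> ->]].
    by rewrite f1.
  by rewrite f1 !group1 !eqxx.
apply/setP=> -[b a]; rewrite !inE mem_twisted_diag /=.
apply/idP/eqP => [/and3P[/andP[Qa /eqP->] /eqP fa1 _] | [-> ->]].
  by congr (_, _); rewrite ?fa1 //; apply: fI => //; rewrite fa1 f1.
by rewrite f1 !group1 !eqxx.
Qed.

Lemma biset_add_orbits X D k : biset_generated G X -> ftwist G D ->
  exists Y : biset T, [/\ biset_generated G Y,
    forall y : Y, (exists x : X, bstab y = bstab x) \/ #|bstab y| = #|D|,
    mark Y D = (mark X D + k * #|'N_H(D) : D|)%N
    & forall U, U \subset H -> #|D| <= #|U| ->
        U \notin [set (D :^ u)%G | u in H] -> mark Y U = mark X U].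
Proof.
move=> gX tD; elim: k => [|k [Y [gY sY YD YU]]].
  by exists X; split=> // [y|]; [left; exists y | rewrite addn0].
have [sDH D1l D1r] := ftwist_free tD.
have [Z [stZ Zm]] := biset_add_orbit Y sDH D1l D1r.
exists Z; split.
- apply: ftwist_generated => w; have [[y ->] | [u Hu ->]] := stZ w.
    exact: generated_ftwist.
  exact: fpair_ftwist (fpair_conj G sDH Hu) tD.
- move=> w; have [[y ->] | [u Hu ->]] := stZ w; first exact: sY.
  by right; rewrite cardJg.
- by rewrite Zm // YD (card_afix_coset_self sDH) mulSn addnAC addnA.
by move=> U sUH leDU nDU; rewrite Zm // (card_afix_coset0 sUH leDU nDU) addn0 YU.
Qed.

(** Induction on the number of subgroups of order [n] whose mark is still wrong. Copies of (T x T)/D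
    correct the mark at [D] and its conjugates and disturb no other mark at orders at least [n], so
    the targets are reached independently. *)
Lemma biset_set_marks X n (M : {group gT * gT} -> nat) :
    biset_generated G X ->
    (forall D u, u \in H -> ftwist G D -> #|D| = n -> M (D :^ u)%G = M D) ->
    (forall D, ftwist G D -> #|D| = n ->
       mark X D <= M D /\ #|'N_H(D) : D| %| M D - mark X D) ->
  exists Y : biset T, [/\ biset_generated G Y,
    forall y : Y, (exists x : X, bstab y = bstab x) \/ #|bstab y| = n,
    forall U, U \subset H -> n < #|U| -> mark Y U = mark X U
    & forall D, ftwist G D -> #|D| = n -> mark Y D = M D].
Proof.
move=> gX MJ; pose bad (X : biset T) :=
  [set D : {group gT * gT} | [&& ftwist G D, #|D| == n & mark X D != M D]].
have [m] := ubnP #|bad X|; elim: m X gX => // m IHm X gX lt_m HM.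
have [bad0 | [D]] := set_0Vmem (bad X).
  exists X; split=> // [x|D tD nD]; first by left; exists x.
  apply/eqP; apply: contraT => neq.
  by have := in_set0 D; rewrite -bad0 inE tD nD eqxx neq.
move=> badD; have := badD; rewrite inE => /and3P[tD /eqP nD neq].
have [leM /dvdnP[k ek]] := HM D tD nD.
have [Y [gY sY YD YU]] := biset_add_orbits k gX tD.
have {}YD : mark Y D = M D by rewrite YD -ek subnKC.
have [sDH _ _] := ftwist_free tD.
have markY V : ftwist G V -> #|V| = n ->
    mark Y V = mark X V \/ mark Y V = M V.
  move=> tV nV; have [sVH _ _] := ftwist_free tV.
  have [/imsetP[u Hu ->] | nDV] := boolP (V \in [set (D :^ u)%G | u in H]).
    by right; rewrite MJ // -YD mark_conj.
  by left; rewrite YU // nD nV.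
have [||Z [gZ sZ ZU ZD]] := IHm Y gY.
- apply: leq_trans (lt_m : _ <= m); apply: proper_card; apply/properP; split.
    apply/subsetP=> V; rewrite !inE => /and3P[tV /eqP nV neqV].
    rewrite tV nV eqxx /=; have [<- // | e] := markY V tV nV.
    by rewrite e eqxx in neqV.
  by exists D; rewrite // inE YD eqxx !andbF.
- move=> V tV nV; have [-> | ->] := markY V tV nV; first exact: HM.
  by rewrite leqnn subnn.
exists Z; split=> // [z | U sUH ltnU].
  have [[y ->] | nz] := sZ z; last by right.
  by have [? | ->] := sY y; [left | right].
rewrite ZU // YU //.
  by rewrite nD ltnW.
apply/negP=> /imsetP[u Hu eU]; move: ltnU.
by rewrite eU cardJg nD ltnn.
Qed.

End BisetConstructions.

(** * Fixed points of twisted diagonals *)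

Section NormTwisted.

Variables (gT : finGroupType) (T : {group gT}).
Implicit Types (A B C P Q R : {group gT}) (f g h : gT -> gT).
Implicit Types (U V W D : {group gT * gT}) (X : biset T).

Notation H := (setX T T).

Lemma norm_twisted_diagP Q f b a : morphic Q f ->
  reflect [/\ a \in 'N_T(Q), b \in 'N_T(f @: Q)
            & {in Q, forall x, f (x ^ a) = f x ^ b}]
          ((b, a) \in 'N_H(twisted_diag Q f)).
Proof.
move=> fM; pose R := (morphm fM @* Q)%G.
have eR : R = f @: Q :> {set gT} by rewrite /= morphimEdom.
apply: (iffP setIP) => [[/mem_setXP[/= Tb Ta] Nu] | ].
  have H x : x \in Q -> x ^ a \in Q /\ f (x ^ a) = f x ^ b.
    move=> Qx; have: (f x, x) ^ (b, a) \in twisted_diag Q f.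
      by rewrite memJ_norm // mem_twisted_diag Qx /=.
    have -> : (f x, x) ^ (b, a) = (f x ^ b, x ^ a) by [].
    by rewrite mem_twisted_diag => /andP[/= ? /eqP].
  split; last by move=> x /H[].
    rewrite inE Ta inE; apply/subsetP=> _ /imsetP[x Qx ->].
    by case: (H x Qx).
  rewrite inE Tb -eR inE; apply/subsetP=> y /imsetP[z]; rewrite eR.
  case/imsetP=> x Qx -> ->; have [Qxa <-] := H x Qx.
  exact: imset_f.
case=> /setIP[Ta Na] /setIP[Tb Nb] e; split; first exact/mem_setXP.
rewrite inE; apply/subsetP=> _ /imsetP[[c d] + ->].
rewrite mem_twisted_diag /= => /andP[Qd /eqP->].
have -> : (f d, d) ^ (b, a) = (f d ^ b, d ^ a) by [].
by rewrite mem_twisted_diag /= memJ_norm // Qd /= e.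
Qed.

Lemma bact_l_fix X (w : X) Q f c : Q \subset T -> f @: Q \subset T ->
  c \in 'C_T(f @: Q) ->
  (bact X w (c, 1) \in bfix X Q f) = (w \in bfix X Q f).
Proof.
move=> sQT sfT /setIP[Tc Cc].
have Hc : (c, 1) \in H by apply/mem_setXP; rewrite /= Tc group1.
have sD : twisted_diag Q f \subset H by rewrite twisted_diag_sub sQT.
rewrite !mem_fix // bstab_conj // -sub_conjgV.
suff -> : twisted_diag Q f :^ (c, 1)^-1 = twisted_diag Q f by [].
rewrite -groupV in Cc; set c' := c^-1 in Cc.
have eJ x : x \in Q -> (f x, x) ^ (c, 1)^-1 = (f x, x).
  move=> Qx; have -> : (f x, x) ^ (c, 1)^-1 = (f x ^ c', x ^ 1^-1) by [].
  rewrite invg1 conjg1; congr (_, _); apply/conjg_fixP/commgP.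
  by apply/commute_sym/(centP Cc)/imset_f.
apply/setP=> u; apply/imsetP/imsetP => [[_ /imsetP[x Qx ->] ->] | [x Qx ->]].
  by exists x; rewrite ?eJ.
exists (f x, x); first by rewrite mem_twisted_diag Qx /=.
by rewrite eJ.
Qed.

Lemma bact_l_inj X (w : X) c d : c \in T -> d \in T ->
  bact X w (c, 1) = bact X w (d, 1) -> c = d.
Proof.
move=> Tc Td e; apply/eqP; rewrite eq_mulgV1; apply/eqP.
have Hc t : t \in T -> (t, 1) \in H by move=> Tt; rewrite inE /= Tt group1.
apply: (bstab_l1 (w := w)); rewrite mem_bstab Hc ?groupM ?groupV //=.
have e1 : (c, 1) * (d, 1)^-1 = (c * d^-1, 1 * 1^-1) :> gT * gT by [].
rewrite mulgV in e1; rewrite -e1.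
by rewrite bact_mul ?groupV ?Hc // e -bact_mul ?groupV ?Hc // mulgV bact1.
Qed.

(** C_T(f(Q)) x 1 centralizes (Q, f), so it acts on the fixed points, and it does so freely. *)
Lemma card_cent_mark X Q f : Q \subset T -> f @: Q \subset T ->
  0 < mark X (twisted_diag Q f) -> #|'C_T(f @: Q)| <= mark X (twisted_diag Q f).
Proof.
move=> sQT sfT /card_gt0P[w Fw].
rewrite -(card_in_imset (f := fun c => bact X w (c, 1)) (D := 'C_T(f @: Q))).
  apply/subset_leq_card/subsetP=> _ /imsetP[c Cc ->].
  by have := bact_l_fix w sQT sfT Cc; rewrite /bfix => ->.
by move=> c d /setIP[Tc _] /setIP[Td _]; apply: bact_l_inj.
Qed.

(** With no more fixed points than elements of C_T(f(Q)), a single free orbit exhausts them. *)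
Lemma cent_transitive X Q f w w' : Q \subset T -> f @: Q \subset T ->
    mark X (twisted_diag Q f) <= #|'C_T(f @: Q)| ->
    w \in bfix X Q f -> w' \in bfix X Q f ->
  exists2 c, c \in 'C_T(f @: Q) & w' = bact X w (c, 1).
Proof.
move=> sQT sfT le_mark Fw Fw'.
pose O := [set bact X w (c, 1) | c in 'C_T(f @: Q)].
have sO : O \subset bfix X Q f.
  by apply/subsetP=> _ /imsetP[c Cc ->]; rewrite bact_l_fix.
have cO : #|O| = #|'C_T(f @: Q)|.
  apply: card_in_imset => c d /setIP[Tc _] /setIP[Td _]; exact: bact_l_inj.
have /eqP eO : O == bfix X Q f by rewrite eqEcard sO cO.
by move: Fw'; rewrite -eO => /imsetP[c]; exists c.
Qed.

End NormTwisted.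

(** * A congruence between numbers of fixed points *)

Section Congruence.

Variables (gT : finGroupType) (T : {group gT}) (G : fusion_system T).
Implicit Types (A B C P Q R : {group gT}) (f g h : gT -> gT).
Implicit Types (U V W D E : {group gT * gT}) (X : biset T).

Notation H := (setX T T).

(** By Cauchy-Frobenius: [u] fixes in X^V exactly the points fixed by <V, u>, so the sum is |N|
    times the number of [N]-orbits on X^V. *)
Lemma sum_mark_cyclic X V (N : {group gT * gT}) : V \subset H -> N \subset 'N_H(V) ->
  #|N| %| \sum_(u in N) mark X (V <*> <[u]>).
Proof.
move=> sVH sN.
have NactV : [acts N, on 'Fix_(bact X)(V) | bact X].
  have := acts_subnorm_fix (bact X) V; rewrite (setIidPr sVH).
  exact: subset_trans.
have sNH : N \subset H by apply: subset_trans sN (subsetIl _ _).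
rewrite -(dvdn_addl _ (dvdnn #|N|)) dvdn_addl //.
rewrite [X in _ %| X](_ : _ = (#|orbit (bact X) N @: 'Fix_(bact X)(V)| * #|N|)%N).
  exact: dvdn_mull.
rewrite -Frobenius_Cauchy //; apply: eq_bigr => u Nu.
have Hu : u \in H by apply: (subsetP sNH).
by rewrite /mark afixYin ?cycle_subG // afix_cycle_in.
Qed.

(* Cauchy-Frobenius for the actions of N(V) on X^V and, through (f2, f1), on   *)
(* X^E: the contributions of the elements outside V agree by stability.        *)
Lemma mark_congr X V E A B f1 f2 :
    (forall U W, fpair G U W -> #|V| < #|U| -> mark X U = mark X W) ->
    G A T f1 -> G B T f2 -> 'N_H(V) \subset setX B A ->
    E = pairf f2 f1 @: V :> {set _} -> V \subset H ->
  mark X V = mark X E %[mod #|'N_H(V) : V|]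
  /\ #|'N_H(V) : V| %| #|'N_H(E) : E|.
Proof.
move=> sX Gf1 Gf2 sNBA eE sVH.
have [_ sBT fM2 _ _] := fusion_mono Gf2; have [_ sAT fM1 _ _] := fusion_mono Gf1.
have sVN : V \subset 'N_H(V) by rewrite subsetI sVH normG.
have sVBA := subset_trans sVN sNBA.
pose phi := pairm fM2 fM1; pose N := [group of 'N_H(V)]; pose N' := (phi @* N)%G.
have eN' : N' = pairf f2 f1 @: N :> {set _} by rewrite /= morphimEsub.
have inj : {in N &, injective (pairf f2 f1)}.
  by apply: sub_in2 (pairf_inj Gf1 Gf2) => u /(subsetP sNBA).
have phiE U : U \subset setX B A -> phi @* U = pairf f2 f1 @: U.
  by move=> sU; rewrite morphimEsub.
have eE' : E = phi @* V :> {set _} by rewrite phiE.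
have sBAH : pairf f2 f1 @: setX B A \subset H.
  apply/subsetP=> _ /imsetP[u /mem_setXP[Bu Au] ->].
  by apply/mem_setXP; rewrite /= (fusion_sub Gf1) // (fusion_sub Gf2).
have sN'H : N' \subset H.
  by rewrite eN'; apply: subset_trans sBAH; apply: imsetS.
have sEH : E \subset H.
  by rewrite eE; apply: subset_trans sBAH; apply: imsetS.
have sN' : N' \subset 'N_H(E).
  by rewrite subsetI sN'H eE' /= morphim_norms // subsetIr.
have cE : #|E| = #|V|.
  by rewrite eE card_in_imset //; apply: sub_in2 inj => u /(subsetP sVN).
have cN : #|N'| = #|N| by rewrite eN' card_in_imset.
have sEN : E \subset 'N_H(E) by rewrite subsetI sEH normG.
split; last first.
  rewrite -(dvdn_pmul2l (cardG_gt0 V)) Lagrange // -cE Lagrange //.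
  by rewrite -[X in X %| _]cN cardSg.
have dV := sum_mark_cyclic X sVH (subxx N).
have := sum_mark_cyclic X sEH sN'.
rewrite cN eN' big_imset //= => dE.
have eqN : \sum_(u in N | u \notin V) mark X (V <*> <[u]>) =
           \sum_(u in N | u \notin V) mark X (E <*> <[pairf f2 f1 u]>).
  apply: eq_bigr => u /andP[Nu nVu].
  have Du : u \in setX B A by apply: (subsetP sNBA).
  have sVuD : V <*> <[u]> \subset setX B A by rewrite join_subG sVBA cycle_subG.
  have eW : E <*> <[pairf f2 f1 u]> = pairf f2 f1 @: (V <*> <[u]>).
    rewrite -phiE // morphimY ?cycle_subG // -eE'.
    by rewrite morphim_cycle.
  apply: sX; last first.
    apply: proper_card; rewrite properEneq joing_subl andbT.
    apply: contraNneq nVu => ->.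
    by rewrite -cycle_subG joing_subr.
  by apply/fpairP; exists A, B, f1, f2; split.
have eV : \sum_(u in N | u \in V) mark X (V <*> <[u]>) = (#|V| * mark X V)%N.
  rewrite -sum_nat_const; apply: eq_big => [u | u /andP[_ Vu]].
    by rewrite andbC; case Vu: (u \in V) => //=; apply: (subsetP sVN).
  by rewrite (joing_idPl _) ?cycle_subG.
have eEs : \sum_(u in N | u \in V) mark X (E <*> <[pairf f2 f1 u]>) = (#|V| * mark X E)%N.
  rewrite -sum_nat_const; apply: eq_big => [u | u /andP[_ Vu]].
    by rewrite andbC; case Vu: (u \in V) => //=; apply: (subsetP sVN).
  rewrite (joing_idPl _) ?cycle_subG // eE.
  exact: imset_f.
move: dV dE; rewrite (bigID (mem V)) /= eV [X in _ -> _ %| X -> _](bigID (mem V)) /=.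
rewrite eEs -eqN.
move=> dV dE; apply/eqP.
(* Multiplication by |V| turns the modulus into |N(V)|; after adding the common sum over the
   elements outside [V], both sides are divisible by it. *)
rewrite -(eqn_pmul2l (cardG_gt0 V)) !muln_modr Lagrange //.
by rewrite -(eqn_modDr (\sum_(u in N | u \notin V) mark X (V <*> <[u]>)))
  (eqP dV) (eqP dE).
Qed.

End Congruence.

(** * Centric fixed points before a class is treated *)

Section Step.

Variables (gT : finGroupType) (p : nat) (S : {group gT}) (F : fusion_system S).
Implicit Types (A B C P Q R : {group gT}) (f g h : gT -> gT).
Implicit Types (U V W D E : {group gT * gT}) (X : biset S).
Hypotheses (pS : p.-group S) (satF : saturated p F).

Notation H := (setX S S).

(** Two extensions: on the left, [fusion_ext_norm] reaches all of N_S(f(Q')) since [Q] is fully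
    normalized. On the right, an element [a] with (b, a) normalizing [V] lies in the extension
    domain of [f2 \o f], with [f2 b] as the required element of N_S(Q). *)
Lemma norm_fpair_fully_normalized V Q : ftwist F V ->
    fpair F V (twisted_diag Q id) -> fully_normalized F Q ->
  exists A B f1 f2, [/\ F A S f1, F B S f2, 'N_H(V) \subset setX B A
    & twisted_diag Q id = pairf f2 f1 @: V].
Proof.
case/ftwistP=> Q' [f [Ff eV]] pVQ nQ; have cV := fpair_card pVQ.
case/fpairP: pVQ => [A0 [B0 [g1 [g2 [Fg1 Fg2]]]]].
rewrite eV twisted_diag_sub => /andP[sQ'A sfB] eQ.
rewrite eV !card_twisted_diag in cV.
have g1Q x : x \in Q' -> g2 (f x) \in Q.
  move=> Qx; have : pairf g2 g1 (f x, x) \in twisted_diag Q id.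
    by rewrite eQ; apply: imset_f; rewrite mem_twisted_diag Qx /=.
  by rewrite mem_twisted_diag /= => /andP[Qg1 /eqP->].
have [R eR] := fusion_img Ff.
have Fg2R : F R S g2 by apply: fusion_res Fg2 _; rewrite eR.
have g2R : g2 @: R = Q.
  apply/eqP; rewrite eqEcard (fusion_card Fg2R) eR (fusion_card Ff) cV leqnn andbT.
  by apply/subsetP=> _ /imsetP[_ /imsetP[x Qx ->] ->]; apply: g1Q.
have [f2 Ff2 f2R] := fusion_ext_norm pS satF Fg2R g2R nQ.
have sRN : R \subset 'N_S(R) by rewrite subsetI normG andbT eR; case/fusion_mono: Ff.
have Ff2f : F Q' S (f2 \o f).
  by apply: fusion_comp_cod Ff Ff2 _; rewrite -eR.
have eQ' : (f2 \o f) @: Q' = Q by rewrite imset_comp -eR f2R.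
have [f1 Ff1 ef1] := satF.2 Q' Q _ Ff2f eQ' (satF.1 Q nQ).1.
exists (ext_domain_group S Q' (f2 \o f)), 'N_S(R)%G, f1, f2; split=> //.
  apply/subsetP=> -[b a].
  have [_ _ fM _ _] := fusion_mono Ff.
  case/(norm_twisted_diagP _ _ _ fM) => Na Nb efab.
  apply/mem_setXP; split; rewrite /= ?eR //.
  apply/mem_ext_domain; split=> //; exists (f2 b).
    rewrite eQ' inE; have Nb' : b \in 'N_S(R) by rewrite eR.
    rewrite (fusion_sub Ff2) //= inE; apply/subsetP=> _ /imsetP[x + ->].
    rewrite -{1}f2R => /imsetP[y Ry ->].
    rewrite -(fusionJ Ff2) ?(subsetP sRN y) // -f2R imset_f //.
    by rewrite memJ_norm //; case/setIP: Nb'.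
  move=> x Qx; have Rfx : f x \in R by rewrite eR imset_f.
  by rewrite /= efab // (fusionJ Ff2) ?(subsetP sRN (f x)) //= eR.
rewrite /twisted_diag -eQ' -!imset_comp; apply: eq_in_imset => x Qx /=.
by rewrite /pairf /= ef1.
Qed.

(* X meets all requirements at the subgroups of order at least n, and none of  *)
(* its points has a smaller stabilizer.                                        *)
Record staged X n : Prop := Staged {
  stg_gen : biset_generated F X;
  stg_stab : forall w : X, n <= #|bstab w|;
  stg_stable : forall U V, fpair F U V -> n <= #|U| -> mark X U = mark X V;
  stg_pos : forall D, ftwist F D -> n <= #|D| -> 0 < mark X D;
  stg_centric : forall Q f, fcentric F Q -> F Q S f -> n <= #|Q| ->
    mark X (twisted_diag Q f) <= #|'C_S(Q)|
}.

(* N_f > Q: all points fixed by (Q, f) are C_S(f(Q))-translates of one fixed by *)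
(* an extension of (Q, f) to N_f; otherwise (Q, f) has no fixed point yet.     *)
Lemma staged_centric X n Q f : staged X n.+1 -> fcentric F Q -> F Q S f ->
    #|Q| = n ->
  mark X (twisted_diag Q f) = #|'C_S(Q)| \/
  mark X (twisted_diag Q f) = 0 /\
    #|'N_H(twisted_diag Q f) : twisted_diag Q f| = #|'C_S(Q)|.
Proof.
move=> stX cQ Ff nQ; have [gX sX stabX pX cX] := stX.
have [sQS _ fM fI sfS] := fusion_mono Ff.
have [g Fg efg] := fcentric_extends satF cQ Ff.
set N := ext_domain_group S Q f in Fg.
have QsubN x : x \in N -> x \in 'N_S(Q) by case/mem_ext_domain.
have sQN : Q \subset N.
  apply/subsetP=> a Qa; apply/mem_ext_domain; split.
    by rewrite inE (subsetP sQS) // (subsetP (normG Q)).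
  have [fQ efQ] := fusion_img Ff.
  exists (f a); last by move=> x Qx; rewrite (fusionJ Ff).
  rewrite -efQ inE (subsetP (normG fQ)) ?efQ ?imset_f // andbT.
  exact: (subsetP sfS (f a) (imset_f f Qa)).
have gM : morphic N g by case/fusion_mono: Fg.
have cfQ := fcentric_card_cent cQ Ff.
have sfQg (R : {group gT}) : Q \subset R -> f @: Q \subset g @: R.
  move=> sQR; apply/subsetP=> _ /imsetP[x Qx ->]; rewrite -efg //.
  exact/imset_f/(subsetP sQR).
(* The stabilizer (R, r) of [w] is larger than (Q, f), so N_R(Q) is larger than [Q] in the p-group
   [R]. It lies in [N], and by unique extension [r] and [g] agree on it up to some [z] centralizing
   f(Q). *)
have subN w : w \in bfix X Q f -> exists R z,
    [/\ Q \proper R, R \subset N, z \in 'C_S(f @: Q)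
      & bact X w (z, 1)^-1 \in bfix X R g].
  have sV : twisted_diag Q f \subset H by rewrite twisted_diag_sub sQS.
  rewrite mem_fix // => sVw; have [R [r [Fr er]]] := gX w.
  have := sX w; rewrite er card_twisted_diag => ltnR.
  move: sVw; rewrite er sub_twisted_diag => /andP[sQR /forall_inP efr].
  have efr' x : x \in Q -> f x = r x by move=> Qx; apply/eqP/efr.
  have sRS : R \subset S by case/fusion_mono: Fr.
  have nilR : nilpotent R by apply: pgroup_nil (pgroupS sRS pS).
  have prQR : Q \proper R by rewrite properEcard sQR nQ.
  have prQN := nilpotent_proper_norm nilR prQR.
  have sNR : 'N_R(Q) \subset R := subsetIl _ _.
  have sNS : 'N_R(Q) \subset 'N_S(Q) by apply: setSI.
  have sRN : 'N_R(Q) \subset N.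
    apply/subsetP=> a Na; apply/mem_ext_domain; split; first exact: (subsetP sNS).
    have [Ra _] := setIP Na.
    exists (r a).
      have -> : f @: Q = r @: Q by apply: eq_in_imset.
      have sQN' := proper_sub prQN.
      exact: (subsetP (fusion_norm_img (fusion_res Fr sNR) sQN' sNS) _ (imset_f r Na)).
    move=> x Qx; rewrite !efr' //; last by rewrite memJ_norm //; case/setIP: Na.
    by rewrite (fusionJ Fr) ?(subsetP sQR x).
  have [z Cz ez] : exists2 z, z \in 'C_S(g @: Q)
       & {in 'N_R(Q)%G, forall x, r x = g x ^ z}.
    apply: (fusion_unique_extension pS satF cQ (proper_sub prQN) sNS).
    - exact: fusion_res Fg sRN.
    - exact: fusion_res Fr sNR.
    by move=> x Qx; rewrite efg ?efr'.
  exists 'N_R(Q)%G, z; split=> //; first by rewrite -(eq_in_imset efg).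
  have Hz : (z, 1) \in H by apply/mem_setXP; rewrite group1; case/setIP: Cz.
  rewrite mem_fix; last first.
    rewrite twisted_diag_sub (subset_trans sNR) //=.
    by case/fusion_mono: (fusion_res Fg sRN).
  rewrite bstab_conj ?groupV // -sub_conjg er.
  apply/subsetP=> _ /imsetP[_ /imsetP[x Nx ->] ->].
  have -> : (g x, x) ^ (z, 1) = (g x ^ z, x ^ 1) by [].
  by rewrite conjg1 mem_twisted_diag /= ez // eqxx (subsetP sNR).
have [eNQ | neq] := eqVneq (N : {set gT}) Q.
  right; have mark0 : mark X (twisted_diag Q f) = 0.
    apply/eqP; rewrite -leqn0 leqNgt; apply/negP=> /card_gt0P[w Fw].
    have [R [z [prQR sRN _ _]]] := subN w Fw.
    by have := proper_sub_trans prQR sRN; rewrite eNQ properxx.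
  split=> //; have [fQ efQ] := fusion_img Ff.
  pose V := Group (twisted_diag_group_set fM).
  have sV : V \subset H by rewrite twisted_diag_sub sQS.
  have sVN : V \subset 'N_H(V) by rewrite subsetI sV normG.
  (* If (b, a) normalizes [V], then [a] lies in N = Q, and dividing by (f a, a) leaves an element
     centralizing f(Q). *)
  have eN : 'N_H(V) = V * setX 'C_S(fQ) 1.
    apply/eqP; rewrite eqEsubset; apply/andP; split; last first.
      rewrite mul_subG //; apply/subsetP=> -[c d] /mem_setXP[/= /setIP[Sc Cc] /set1P->].
      apply/(norm_twisted_diagP _ _ _ fM); split; rewrite ?group1 //.
        by rewrite -efQ inE Sc (subsetP (cent_sub _)).
      move=> x Qx; rewrite conjg1; apply/esym/conjg_fixP/commgP.
      by apply/commute_sym/(centP Cc); rewrite efQ imset_f.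
    apply/subsetP=> -[b a] /(norm_twisted_diagP _ _ _ fM)[Na Nb e].
    have Qa : a \in Q by rewrite -eNQ; apply/mem_ext_domain; split=> //; exists b.
    have Sfa : f a \in S by apply/(subsetP sfS)/imset_f.
    have -> : (b, a) = (f a, a) * ((f a)^-1 * b, 1).
      by congr (_, _); rewrite ?mulKVg ?mulg1.
    apply: mem_mulg; first by rewrite mem_twisted_diag /= Qa /=.
    apply/mem_setXP; split=> //=; have [Sb _] := setIP Nb.
    rewrite inE groupM ?groupV //=; apply/centP=> y.
    rewrite efQ => /imsetP[x Qx ->]; apply/commute_sym/commgP/conjg_fixP.
    rewrite conjgM -[x in LHS](conjgKV a) (fusionJ Ff) ?groupJ ?groupV // conjgK.
    by rewrite -e ?groupJ ?groupV // conjgKV.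
  have cN : #|'N_H(V)| = (#|V| * #|'C_S(Q)|)%N.
    rewrite eN TI_cardMg ?cardsX ?cards1 ?muln1 ?efQ ?cfQ //.
    apply/trivgP/subsetP=> -[b a] /setIP[]; rewrite mem_twisted_diag /=.
    case/andP=> _ /eqP-> /mem_setXP[_ /set1P /= ->].
    by rewrite -(morphmE fM) morph1 set11.
  apply/eqP; rewrite -(eqn_pmul2l (cardG_gt0 V)) (Lagrange sVN).
  exact/eqP.
left; have prQN : Q \proper N by rewrite properEneq eq_sym neq.
have ltnN : n < #|N| by rewrite -nQ proper_card.
have /card_gt0P[w0 Fw0] : 0 < mark X (twisted_diag N g).
  apply: (pX (Group (twisted_diag_group_set gM))); last first.
    by rewrite card_twisted_diag.
  by apply/ftwistP; exists N, g.
have w0R R : R \subset N -> w0 \in bfix X R g.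
  move=> sRN; apply: (subsetP (afixS _ _)) Fw0.
  by rewrite sub_twisted_diag sRN; apply/forall_inP.
have Fw0f : w0 \in bfix X Q f by rewrite /bfix -(eq_twisted_diag efg) w0R.
apply/eqP; rewrite eqn_leq -{2}cfQ card_cent_mark // ?andbT; last first.
  by apply/card_gt0P; exists w0.
apply: leq_trans (_ : #|[set bact X w0 (c, 1) | c in 'C_S(f @: Q)]| <= _); last first.
  by rewrite -cfQ leq_imset_card.
apply/subset_leq_card/subsetP=> w Fw.
(* A translate of [w] and the point [w0] are both fixed by (R, g), with [R] centric and larger than
   [Q]. By the previous stage such points form one orbit of C_S(g(R)), which centralizes f(Q). *)
have [R [z [prQR sRN Cz Fw']]] := subN w Fw.
have sQR := proper_sub prQR.
have FgR := fusion_res Fg sRN.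
have sRS : R \subset S by case/fusion_mono: FgR.
have cR := fcentricS cQ sQR sRS.
have [c Cc ew] : exists2 c, c \in 'C_S(g @: R)
     & bact X w (z, 1)^-1 = bact X w0 (c, 1).
  apply: (cent_transitive sRS _ _ (w0R R sRN) Fw').
    by case/fusion_mono: FgR.
  rewrite (fcentric_card_cent cR FgR) cX //.
  by rewrite -nQ proper_card.
have [[Sz Cz'] [Sc Cc']] := (setIP Cz, setIP Cc).
have Hz : (z, 1) \in H by rewrite inE /= Sz group1.
have Hc : (c, 1) \in H by rewrite inE /= Sc group1.
apply/imsetP; exists (c * z).
  apply/setIP; split; first by rewrite groupM.
  apply: groupM => //.
  exact: (subsetP (centS (sfQg R sQR))).
have -> : (c * z, 1) = (c, 1) * (z, 1) :> gT * gT by congr (_, _); rewrite mulg1.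
by rewrite bact_mul // -ew -bact_mul ?groupV // mulVg bact1.
Qed.

End Step.

Section Stages.

Variables (gT : finGroupType) (p : nat) (S : {group gT}) (F : fusion_system S).
Implicit Types (A B C P Q R : {group gT}) (f g h : gT -> gT).
Implicit Types (U V W D E : {group gT * gT}) (X : biset S).
Hypotheses (pS : p.-group S) (satF : saturated p F).

Notation H := (setX S S).

(** * A characteristic biset with few centric fixed points *)

(* Adding orbits with stabilizers conjugate to D can raise all marks of the    *)
(* class of D to M; M > 0 makes every (Q, f) with f in F fix a point. *)
Definition attainable X (D : {group gT * gT}) (M : nat) : bool :=
  (0 < M) && [forall V : {group gT * gT}, fpair F D V ==>
    ((mark X V <= M) && (#|'N_H(V) : V| %| M - mark X V))].

Lemma attainableP X D M :
  reflect (0 < M /\ forall V, fpair F D V ->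
             mark X V <= M /\ #|'N_H(V) : V| %| M - mark X V)
          (attainable X D M).
Proof.
apply: (iffP andP) => -[M0 HM]; split=> //.
  by move=> V DV; apply/andP/(implyP (forallP HM V)).
by apply/forallP=> V; apply/implyP=> /HM/andP.
Qed.

Lemma attainable_fpair X D V M :
  fpair F D V -> attainable X D M -> attainable X V M.
Proof.
move=> DV /attainableP[M0 HM]; apply/attainableP; split=> [|W VW]; first exact: M0.
exact: HM (fpair_trans DV VW).
Qed.

(** All marks in the class are congruent to that of the diagonal [E] of a fully normalized subgroup,
    each modulo the amount by which one new orbit changes it. *)
Lemma exists_attainable X n D : staged F X n.+1 -> ftwist F D -> #|D| = n ->
  exists M, attainable X D M.
Proof.
move=> [gX _ sX _ _] tD nD; have /ftwistP[Q [f [Ff eD]]] := tD.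
have [sQS _ fM _ sfS] := fusion_mono Ff; have [R eR] := fusion_img Ff.
have sRS : R \subset S by rewrite eR.
have [Q0 [c [Fc cR nQ0]]] := exists_fully_normalized F sRS.
have idM : morphic Q0 id by apply/morphicP.
pose E := Group (twisted_diag_group_set idM).
have Fcf : F Q S (c \o f) by apply: fusion_comp_cod Ff Fc _; rewrite eR.
have DE : fpair F D E.
  apply/fpairP; exists Q, R, (c \o f), c; split=> //.
    by rewrite eD twisted_diag_sub eR !subxx.
  by rewrite eD /= /twisted_diag -cR eR -!imset_comp; apply: eq_in_imset.
(* The second summand is a multiple of every index in the class and exceeds every mark; the
   successor keeps it positive even for empty [X]. *)
exists (mark X E + #|X|.+1 * #|'N_H(E) : E|)%N.
have leX V : mark X V <= #|X|.+1 * #|'N_H(E) : E|.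
  apply: leq_trans (max_card _) _; apply: leq_trans (leqnSn _) _.
  by rewrite leq_pmulr // indexg_gt0.
apply/attainableP; split; first by rewrite addn_gt0 muln_gt0 indexg_gt0 orbT.
move=> V DV; have VE : fpair F V E by apply: fpair_trans (fpair_sym DV) DE.
have tV := fpair_ftwist DV tD.
have [A [B [f1 [f2 [Ff1 Ff2 sN eE]]]]] := norm_fpair_fully_normalized pS satF tV VE nQ0.
have nV : #|V| = n by rewrite (fpair_card DV).
have sX' U W : fpair F U W -> #|V| < #|U| -> mark X U = mark X W.
  by rewrite nV => UW ltU; apply: sX.
have [congr dvd] := mark_congr sX' Ff1 Ff2 sN (eE : E = _ :> {set _}) (fpair_subl VE).
have leM := leq_trans (leX V) (leq_addl (mark X E) _).
split=> //; rewrite -eqn_mod_dvd //; apply/eqP; rewrite congr.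
by rewrite -modnDmr (eqP (dvdn_mull _ dvd)) addn0.
Qed.

(** By [staged_centric], each member of the class either has this mark already or has mark 0 and
    index |C_S(Q)|, so that one orbit fills the gap. *)
Lemma attainable_centric X n Q f D : staged F X n.+1 -> fcentric F Q ->
  F Q S f -> D = twisted_diag Q f :> {set _} -> #|Q| = n ->
  attainable X D #|'C_S(Q)|.
Proof.
move=> stX cQ Ff eD nQ; apply/attainableP; split; first exact: cardG_gt0.
move=> V DV; have nV := fpair_card DV.
case/fpairP: DV => A [B [f1 [f2 [Ff1 Ff2]]]].
rewrite eD twisted_diag_sub => /andP[sQA sfB].
have Ff1Q := fusion_res Ff1 sQA; have [R eR] := fusion_img Ff1Q.
have [g [Fg K _ gR]] := fusion_invT Ff1Q (esym eR).
rewrite (pairf_twisted_diag _ _ K) -eR => eV.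
have Fh : F R S (f2 \o f \o g).
  apply: fusion_comp_cod Ff2 _; first exact: fusion_comp Fg Ff.
  by rewrite imset_comp gR.
have cR := fcentric_img cQ Ff1Q (esym eR).
have nR : #|R| = n by rewrite eR (fusion_card Ff1Q).
have eC : #|'C_S(R)| = #|'C_S(Q)| by rewrite eR (fcentric_card_cent cQ Ff1Q).
have [] := staged_centric pS satF stX cR Fh nR.
  by rewrite eV -eC => ->; rewrite leqnn subnn.
by case; rewrite eV -eC => -> ->; rewrite subn0.
Qed.

(* The least attainable value depends only on the class of D, and is at most   *)
(* |C_S(Q)| when Q is centric.                                                 *)
Lemma staged_step X n : staged F X n.+1 -> exists Y, staged F Y n.
Proof.
move=> stX; have [gX stabX sX pX cX] := stX.
(* The minimal values are chosen for all subgroups at once, with dummy value 0 where nothing is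
   required. *)
have [M HM] : exists M : {group gT * gT} -> nat, forall D, ftwist F D -> #|D| = n ->
    attainable X D (M D) /\ forall m, attainable X D m -> M D <= m.
  apply: (@fin_all_exists {group gT * gT} (fun=> nat) (fun D M => ftwist F D ->
    #|D| = n -> attainable X D M /\ forall m, attainable X D m -> M <= m)) => D.
  have [/andP[tD /eqP nD] | nD] := boolP (ftwist F D && (#|D| == n)).
    have [M AM minM] := ex_minnP (exists_attainable stX tD nD).
    by exists M.
  by exists 0 => tD nDn; rewrite tD nDn eqxx in nD.
have eqM D V : ftwist F D -> #|D| = n -> fpair F D V -> M D = M V.
  move=> tD nD DV; have tV := fpair_ftwist DV tD.
  have nV : #|V| = n by rewrite (fpair_card DV).
  have [[AD mD] [AV mV]] := (HM D tD nD, HM V tV nV).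
  have AD' := attainable_fpair (fpair_sym DV) AV.
  have AV' := attainable_fpair DV AD.
  by apply/eqP; rewrite eqn_leq (mD _ AD') (mV _ AV').
have refl D : ftwist F D -> fpair F D D.
  case/ftwist_free=> sD _ _.
  by have := fpair_conj F sD (group1 _); rewrite conjsg1.
have [||Y [gY stY sameY eqY]] := @biset_set_marks _ _ F X n M gX.
- move=> D u Hu tD nD; have [sD _ _] := ftwist_free tD.
  exact/esym/eqM/(fpair_conj F sD Hu).
- move=> D tD nD; have [/attainableP[_ HD] _] := HM D tD nD.
  exact/HD/refl.
exists Y; split=> //.
- move=> w; have [[x ->] | ->] := stY w; last by [].
  exact: ltnW (stabX x).
- move=> U V UV; rewrite leq_eqVlt => /orP[/eqP nU | ltU].
    have nV := fpair_card UV; rewrite -nU in nV.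
    have [tU | ntU] := boolP (ftwist F U).
      have tV := fpair_ftwist UV tU.
      by rewrite !eqY ?(eqM U V).
    (* Subgroups that are not graphs of morphisms of [F] fix no point of a generated biset, so both
       marks vanish. *)
    have ntV : ~~ ftwist F V.
      by apply: contra ntU; apply/fpair_ftwist/fpair_sym.
    have zero W : ~~ ftwist F W -> W \subset H -> mark Y W = 0.
      move=> ntW sW; apply/eqP; rewrite -leqn0 leqNgt; apply: contra ntW.
      exact: fixed_ftwist.
    by rewrite !zero // ?(fpair_subl UV) ?(fpair_subr UV).
  rewrite !sameY ?(fpair_subl UV) ?(fpair_subr UV) ?(fpair_card UV) //.
  exact: sX.
- move=> D tD; rewrite leq_eqVlt => /orP[/eqP nD | ltD].
    by rewrite eqY //; have [/attainableP[]] := HM D tD (esym nD).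
  by have [sD _ _] := ftwist_free tD; rewrite sameY // pX.
move=> Q f cQ Ff; have [sQS _ fM _ sfS] := fusion_mono Ff.
pose D := Group (twisted_diag_group_set fM).
have tD : ftwist F D by apply/ftwistP; exists Q, f.
have cD : #|D| = #|Q| by rewrite card_twisted_diag.
rewrite -[twisted_diag _ _]/(gval D) leq_eqVlt => /orP[/eqP nQ | ltQ].
  rewrite eqY ?cD //; have [_] := HM D tD (etrans cD (esym nQ)); apply.
  exact: attainable_centric stX cQ Ff _ _.
have [sD _ _] := ftwist_free tD.
by rewrite sameY ?cD // cX.
Qed.

(** Descent from |S| + 1, which exceeds the order of every twisted diagonal, so that the empty biset
    can serve as start. *)
Lemma exists_staged : exists X, staged F X 0.
Proof.
suff H k : exists X, staged F X (#|S|.+1 - k) by rewrite -(subnn #|S|.+1).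
elim: k => [|k [X stX]].
  have [X X0] := empty_biset S; exists X; rewrite subn0.
  have mX (U : {set gT * gT}) : mark X U = 0.
    by apply: eq_card0 => w; case: (X0 w).
  have big U : ftwist F U -> #|S| < #|U| -> False.
    case/ftwistP=> Q [f [Ff ->]]; rewrite card_twisted_diag ltnNge => /negP[].
    by apply: subset_leq_card; case/fusion_mono: Ff.
  split.
  - by move=> w; case: (X0 w).
  - by move=> w; case: (X0 w).
  - by move=> U V _ _; rewrite !mX.
  - by move=> D tD /(big D tD).
  by move=> Q f; rewrite mX.
have [leSk | ltkS] := leqP #|S|.+1 k.
  have /eqP e : #|S|.+1 - k == 0 by rewrite subn_eq0.
  by exists X; rewrite subnS e; rewrite e in stX.
by apply: (staged_step (X := X)); rewrite (subnSK ltkS).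
Qed.

End Stages.

(** * Counting points and embedding bisets *)

Section Normset.

Variables (gT : finGroupType) (T : {group gT}) (G : fusion_system T).
Implicit Types (A B C P Q R : {group gT}) (f g h : gT -> gT) (X Y : biset T).

Notation H := (setX T T).

Lemma mem_normset X P (w : X) Q f : bstab w = twisted_diag Q f ->
  (w \in biset_normset X P) = (P \subset Q) && (f @: P == P).
Proof.
move=> ew; rewrite inE; apply/existsP/andP => [[R /existsP[r]] | [sPQ /eqP fP]].
  rewrite ew => /and3P[/eqP/twisted_diag_inj[<- e] sPQ /eqP rP].
  split=> //; apply/eqP; rewrite -[RHS]rP; apply: eq_in_imset => x Px.
  exact/e/(subsetP sPQ).
exists Q; apply/existsP; exists (finfun f).
have e : finfun f =1 f by move=> x; rewrite ffunE.
rewrite sPQ ew (eq_imset _ e) fP eqxx andbT andbT.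
by apply/eqP/eq_twisted_diag => x _; rewrite e.
Qed.

Lemma mem_centset X P (w : X) Q f : bstab w = twisted_diag Q f -> P \subset T ->
  (w \in biset_centset X P) = (w \in bfix X P id).
Proof.
move=> ew sPT; rewrite mem_fix ?twisted_diag_sub ?imset_id ?sPT //.
rewrite ew sub_twisted_diag inE.
apply/existsP/andP => [[R /existsP[r]] | [sPQ /forall_inP eP]].
  rewrite ew => /and4P[/eqP/twisted_diag_inj[<- e] sPQ _ /forall_inP rP].
  split=> //; apply/forall_inP => x Px.
  by rewrite e ?(subsetP sPQ) // eq_sym rP.
exists Q; apply/existsP; exists (finfun f).
have e : finfun f =1 f by move=> x; rewrite ffunE.
apply/and4P; split=> //.
- by rewrite ew; apply/eqP/eq_twisted_diag => x _; rewrite e.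
- apply/eqP; rewrite -[RHS]imset_id; apply: eq_in_imset => x Px.
  by rewrite e -(eqP (eP x Px)).
by apply/forall_inP=> x Px; rewrite e eq_sym eP.
Qed.

(** The stabilizer of a point of N_X(P) restricts to a unique automorphism of [P], which splits
    N_X(P) into the sets X^(P, a). In [stable_normalizer], [W] is the set of fixed points of a
    further subgroup. *)
Lemma card_normsetI X P (W : {set X}) : biset_generated G X -> P \subset T ->
  #|W :&: biset_normset X P| = \sum_(a in Aut_fusion G P) #|W :&: bfix X P a|.
Proof.
move=> gX sPT.
have sub (a : {perm gT}) : a \in Aut_fusion G P -> twisted_diag P a \subset H.
  case/setIdP=> _ /fusion_mono[_ _ _ _ sa].
  by rewrite twisted_diag_sub sPT (subset_trans sa).
have -> : W :&: biset_normset X P = \bigcup_(a in Aut_fusion G P) (W :&: bfix X P a).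
  apply/setP=> w; apply/setIP/bigcupP => [[Ww Nw] | [a Aa /setIP[Ww Fw]]].
    have [Q [f [Gf ew]]] := gX w; move: Nw.
    rewrite (mem_normset P ew) => /andP[sPQ /eqP fP].
    have GfP : G P P f by apply: fusion_cod (fusion_res Gf sPQ) _ _; rewrite ?fP.
    have [a Aa ea] := fusion_Aut GfP; exists a; rewrite // inE Ww.
    rewrite /bfix (eq_twisted_diag ea) mem_fix; last first.
      by rewrite twisted_diag_sub sPT fP.
    by rewrite ew sub_twisted_diag sPQ; apply/forall_inP.
  split=> //; have [Q [f [Gf ew]]] := gX w.
  move: Fw; rewrite /bfix mem_fix ?sub // ew sub_twisted_diag.
  case/andP=> sPQ /forall_inP eaf; rewrite (mem_normset P ew) sPQ /=.
  rewrite -(eq_in_imset (f := a)); last by move=> x /eaf/eqP.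
  rewrite eqEcard card_imset ?leqnn ?andbT; last exact: perm_inj.
  by have [_ /fusion_mono[]] := setIdP Aa.
rewrite big_mkcond /= -sum1_card partition_disjoint_bigcup.
  rewrite [RHS]big_mkcond /=; apply: eq_bigr => a _.
  by rewrite sum1_card; case: ifP => // _; rewrite cards0.
move=> a b neq_ab; rewrite -setI_eq0.
case: ifP => Aa; last by rewrite set0I eqxx.
case: ifP => Ab; last by rewrite setI0 eqxx.
apply: contraR neq_ab.
case/set0Pn=> w /setIP[/setIP[_ Fa] /setIP[_ Fb]].
have [Q [f [Gf ew]]] := gX w.
move: Fa Fb; rewrite /bfix !mem_fix ?sub // ew !sub_twisted_diag.
case/andP=> _ /forall_inP ea /andP[_ /forall_inP eb].
have [[AutA _] [AutB _]] := (setIdP Aa, setIdP Ab).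
by apply/eqP/(eq_Aut AutA AutB) => x Px; rewrite (eqP (ea x Px)) (eqP (eb x Px)).
Qed.

Lemma mark_Aut X P a : fpair_stable G X -> a \in Aut_fusion G P ->
  mark X (twisted_diag P a) = mark X (twisted_diag P id).
Proof.
move=> sX /setIdP[_ Ga]; have [_ _ aM aI sa] := fusion_mono Ga.
have idM : morphic P id by apply/morphicP.
apply: (sX (Group (twisted_diag_group_set aM)) (Group (twisted_diag_group_set idM))).
apply: (fpair_id (fusion_widen Ga)); apply/eqP.
by rewrite eqEcard sa card_in_imset /=.
Qed.

Lemma card_normset X P : biset_generated G X -> fpair_stable G X -> P \subset T ->
  #|biset_normset X P| = (#|Aut_fusion G P| * mark X (twisted_diag P id))%N.
Proof.
move=> gX sX sPT; rewrite -[biset_normset X P]setTI card_normsetI //.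
rewrite -sum_nat_const; apply: eq_bigr => a Aa.
by rewrite setTI -(mark_Aut sX Aa).
Qed.

Section ModP.

Variables (p : nat) (X : biset T) (P : {group gT}).
Hypotheses (pT : p.-group T) (gX : biset_generated G X).
Hypothesis sPT : P \subset T.
(** Makes membership in N_X(P) visible on the left projection of a stabilizer. It is applied to S in
    F, to C_S(P) in the centralizer system and to [P] in the normalizer system. *)
Hypothesis nPG : forall Q f, G Q T f -> P \subset f @: Q ->
  P \subset Q /\ f @: P = P.

Lemma mem_normset_fst (w : X) :
  (w \in biset_normset X P) = (P \subset [set u.1 | u in bstab w]).
Proof.
have [Q [f [Gf ew]]] := gX w; rewrite (mem_normset P ew) ew -imset_comp.
rewrite (eq_imset (g := f)) //; apply/andP/idP => [[sPQ /eqP {1}<-] | sPfQ].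
  exact: imsetS.
by have [-> ->] := nPG Gf sPfQ.
Qed.

Lemma acts_normsetC : [acts setX P T, on ~: biset_normset X P | bact X].
Proof.
apply/subsetP=> -[b a] Ku; have [/= Pb Ta] := mem_setXP _ _ _ Ku.
have Hu : (b, a) \in H by apply/mem_setXP; rewrite /= (subsetP sPT).
rewrite inE Hu inE; apply/subsetP=> w; rewrite in_setC => NNw; rewrite inE in_setC.
move: NNw; apply: contra.
rewrite !mem_normset_fst bstab_conj // => sP; apply/subsetP=> x Px.
have : x ^ b \in [set u.1 | u in bstab w :^ (b, a)].
  by apply: (subsetP sP); rewrite groupJ.
case/imsetP=> _ /imsetP[[c d] Wcd ->] /= exb.
have {}exb : x ^ b = c ^ b by [].
by apply/imsetP; exists (c, d); rewrite //= -(conjgK b x) exb conjgK.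
Qed.

(* A (P x T)-orbit of X has length |T| |P : P :&: f(Q)|. *)
Lemma dvdn_normsetC : p * #|T| %| #|~: biset_normset X P|.
Proof.
rewrite -(acts_sum_card_orbit acts_normsetC).
apply: dvdn_sum => _ /imsetP[w NNw ->].
have sKH : setX P T \subset H by apply: setXS.
rewrite card_orbit_in //; set C := 'C_(setX P T)[w | bact X].
have sCK : C \subset setX P T := subsetIl _ _.
have [Q [f [Gf ew]]] := gX w; have [sQT _ fM fI sfT] := fusion_mono Gf.
have [R eR] := fusion_img Gf.
have eC : C = setX P T :&: bstab w.
  by apply/setP=> u; rewrite in_setI mem_subastab1 // mem_bstab;
     case Ku: (u \in setX P T); rewrite //= (subsetP sKH).
have cC : #|C| = #|P :&: R|.
  have -> : (P :&: R : {set gT}) = fst @: C.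
    apply/setP=> x; apply/setIP/imsetP => [[Px] | [[b a]]].
      rewrite eR => /imsetP[y Qy ex]; exists (x, y); rewrite // eC ew inE.
      by rewrite mem_twisted_diag /= Qy ex eqxx andbT inE /= -ex Px (subsetP sQT).
    rewrite eC ew => /setIP[/mem_setXP[/= Pb _]].
    rewrite mem_twisted_diag /= => /andP[Qa /eqP eb] ->.
    by rewrite eR eb imset_f // -eb.
  apply/esym/card_in_imset => -[b a] [d c] /=; rewrite eC ew.
  case/setIP=> _; rewrite mem_twisted_diag /= => /andP[Qa /eqP->].
  case/setIP=> _; rewrite mem_twisted_diag /= => /andP[Qc /eqP->] e.
  by congr (_, _) => //; apply: fI.
rewrite -(dvdn_pmul2l (cardG_gt0 [group of C])) Lagrange // cardsX cC.
rewrite mulnA dvdn_pmul2r // -(Lagrange (subsetIl P R)) dvdn_pmul2l //.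
(* Outside N_X(P) the group [P] is not contained in f(Q), so this index is a nontrivial power of
   [p]. *)
have ntI : #|P : P :&: R| != 1%N.
  rewrite indexg_eq1 subsetI subxx /=; move: NNw; rewrite in_setC mem_normset_fst.
  by rewrite ew -imset_comp (eq_imset (g := f)) // -eR.
have: p.-nat #|P : P :&: R| by apply: pnat_dvd (dvdn_indexg P _) (pgroupS sPT pT).
case/p_natP=> // k ek; move: ntI; rewrite ek; case: k {ek} => // k _.
by rewrite expnS dvdn_mulr.
Qed.

(** The points outside N_X(P) number a multiple of p|T|, so the condition prime to [p] can be tested
    on N_X(P) alone. *)
Lemma characteristic_normset :
  (p %| #|X| %/ #|T|) = (p %| #|biset_normset X P| %/ #|T|).
Proof.
have /dvdnP[k ek] := dvdn_normsetC.
rewrite -(cardsC (biset_normset X P)) ek addnC mulnA divnMDl ?cardG_gt0 //.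
by rewrite dvdn_addr ?dvdn_mull.
Qed.

End ModP.

End Normset.

(** Send a representative of each orbit to a point with the same stabilizer and extend
    equivariantly. Stabilizers are preserved, so points with equal images lie in one orbit by the
    second hypothesis, and on an orbit the map is injective. *)
Lemma biset_embedding (gT : finGroupType) (T : {group gT}) (X Y : biset T) :
    (forall x : X, exists y : Y, bstab y = bstab x) ->
    (forall x x' : X, bstab x = bstab x' ->
       exists2 u, u \in setX T T & x' = bact X x u) ->
  biset_embeds X Y.
Proof.
move=> stXY trX; set H := setX T T.
pose O (x : X) := orbit (bact X) H x.
have Oin x : x \in O x by apply: orbit_refl.
have rP x : {u | u \in H & bact X (odflt x [pick z in O x]) u = x}.
  apply/sig2_eqW; case: pickP => [z Oz | /(_ x)]; last by rewrite Oin.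
  by move: Oz; rewrite orbit_in_sym // => /orbitP[u Hu <-]; exists u.
pose rep x := odflt x [pick z in O x].
have rep_eq x u : u \in H -> rep (bact X x u) = rep x.
  move=> Hu; rewrite /rep /O.
  have -> : orbit (bact X) H (bact X x u) = orbit (bact X) H x.
    by apply/orbit_in_eqP => //; apply: mem_orbit.
  by case: pickP => // /(_ x); rewrite orbit_refl.
have [k kst] : exists k : X -> Y, forall x, bstab (k x) = bstab x.
  by apply: (@fin_all_exists X (fun=> Y) (fun x y => bstab y = bstab x)).
pose h x := bact Y (k (rep x)) (s2val (rP x)).
have hP x u : u \in H -> bact X (rep x) u = x -> h x = bact Y (k (rep x)) u.
  move=> Hu eu; rewrite /h; case: (rP x) => v Hv ev /=.
  have: v * u^-1 \in bstab (k (rep x)).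
    rewrite kst mem_bstab groupM ?groupV //= bact_mul ?groupV // ev -{1}eu.
    by rewrite -bact_mul ?groupV // mulgV bact1.
  rewrite mem_bstab => /andP[_ /eqP e].
  by rewrite -[in RHS]e -bact_mul ?mulgKV // groupM ?groupV.
have hst x : bstab (h x) = bstab x.
  rewrite /h; case: (rP x) => v Hv ev /=.
  by rewrite bstab_conj // kst -bstab_conj // ev.
have hequiv : bequivariant h.
  move=> x u Hu; rewrite {2}/h; case: (rP x) => v Hv ev /=.
  rewrite -bact_mul // -(rep_eq x u Hu); apply: hP; first exact: groupM.
  by rewrite rep_eq // bact_mul // -/(rep x) ev.
exists h => // x x' e.
have [u Hu ex'] : exists2 u, u \in H & x' = bact X x u.
  by apply: trX; rewrite -hst e hst.
have : u \in bstab (h x) by rewrite mem_bstab Hu -hequiv // -ex' e /=.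
by rewrite hst mem_bstab ex' => /andP[_ /eqP].
Qed.

Lemma embeds_mark (gT : finGroupType) (T : {group gT}) (X Y : biset T)
    (U : {set gT * gT}) :
  U \subset setX T T -> biset_embeds X Y -> mark X U <= mark Y U.
Proof.
move=> sU [h he hi]; rewrite /mark -(card_imset _ hi).
apply/subset_leq_card/subsetP=> _ /imsetP[x /afixP Fx ->].
apply/afixP=> u Uu.
by rewrite -he ?Fx // (subsetP sU).
Qed.

Lemma embeds_isog (gT : finGroupType) (T : {group gT}) (X Y : biset T) :
  biset_embeds X Y -> biset_embeds Y X -> biset_isog X Y.
Proof.
move=> [h he hi] [k ke ki]; exists h => //; apply: inj_card_bij => //.
by rewrite -(card_codom ki) max_card.
Qed.

Lemma minimal_unique (gT : finGroupType) p (T : {group gT}) (G : fusion_system T)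
    (X Y : biset T) :
  minimal_characteristic_biset p G X -> minimal_characteristic_biset p G Y ->
  biset_isog X Y.
Proof. by move=> [cX mX] [cY mY]; apply: embeds_isog; [apply: mX | apply: mY]. Qed.

(** * The minimal biset at centric subgroups *)

Section MinimalBiset.

Variables (gT : finGroupType) (p : nat) (S : {group gT}) (F : fusion_system S).
Implicit Types (P Q R : {group gT}) (f g h : gT -> gT) (X Y : biset S).
Hypotheses (pr_p : prime p) (pS : p.-group S) (satF : saturated p F).

Notation H := (setX S S).

Lemma card_Aut_inner P :
  (#|conj_aut P @* 'N_S(P)| * #|'C_S(P)|)%N = #|'N_S(P)|.
Proof.
have -> : 'C_S(P) = 'ker_('N_S(P)) (conj_aut P).
  rewrite ker_conj_aut; apply/setP=> x; rewrite !in_setI.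
  case Cx: (x \in 'C(P)); rewrite ?andbF // (subsetP (cent_sub P)) ?Cx //.
  by rewrite !andbT.
by rewrite card_morphim (setIidPr (subsetIr _ _)) mulnC -indexgI Lagrange ?subsetIl.
Qed.

(** [m] is the index in Aut_F(P) of its Sylow subgroup Aut_S(P), which has order |N_S(P) :
    C_S(P)|. *)
Lemma fully_normalized_index P : fully_normalized F P -> exists m,
  ~~ (p %| m) /\ (#|Aut_fusion F P| * #|'C_S(P)|)%N = (m * #|'N_S(P)|)%N.
Proof.
move=> nP; have [_ sylP] := satF.1 P nP; have sPS := nP.1.
have [sAF _ p'i] := and3P sylP.
exists #|Aut_fusion_group F sPS : conj_aut P @* 'N_S(P)|; split.
  by rewrite -p'natE // -p'natE.
rewrite -(card_Aut_inner P) mulnA; congr (_ * _)%N.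
by rewrite mulnC (@Lagrange _ (Aut_fusion_group F sPS) _ sAF).
Qed.

(** [f] maps C_S(P) into C_S(f(P)). As [P] is fully centralized, the orders force equality, so the
    latter lies in f(P). *)
Lemma fully_normalized_fcentric P :
  fully_normalized F P -> 'C_S(P) \subset P -> fcentric F P.
Proof.
move=> nP sCP; split=> [|f Ff]; first exact: nP.1.
have [[_ fcP] _] := satF.1 P nP.
have [sPS _ fM fI sfS] := fusion_mono Ff.
have sfC : f @: 'C_S(P) \subset 'C_S(f @: P).
  apply/subsetP=> _ /imsetP[x Cx ->]; have Px := subsetP sCP x Cx.
  rewrite inE (subsetP sfS) ?imset_f //=; apply/centP=> _ /imsetP[y Py ->].
  rewrite /commute -!(fusionM Ff) //; congr f.
  by have [_ /centP->] := setIP Cx.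
have /eqP <- : f @: 'C_S(P) == 'C_S(f @: P); last exact: imsetS.
rewrite eqEcard sfC card_in_imset ?fcP //.
by apply: sub_in2 fI => x /(subsetP sCP).
Qed.

Lemma onto_fully Q f : F Q S f -> S \subset f @: Q -> S \subset Q /\ f @: S = S.
Proof.
move=> Ff sSfQ; have [sQS _ _ _ sfS] := fusion_mono Ff.
have eQ : Q = S.
  apply/group_inj/eqP; rewrite eqEcard sQS /= -(fusion_card Ff).
  exact: subset_leq_card.
split; first by rewrite eQ.
by apply/eqP; rewrite eqEsubset -{1 4}eQ sfS.
Qed.

Lemma fully_normalized_self : fully_normalized F S.
Proof.
split=> // f Ff; have [_ _ _ _ sfS] := fusion_mono Ff.
rewrite (setIidPl (normG S)); apply: subset_leq_card; exact: subsetIl.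
Qed.

(** Exactly |C_S(S)| points are fixed by (S, id), so N_X(S) has |Aut_F(S)| |C_S(S)| = m|S| points
    with [m] prime to [p]. *)
Lemma staged_characteristic X : staged F X 0 -> characteristic_biset p F X.
Proof.
case=> gX _ sX pX cX.
have sX' : fpair_stable F X by move=> U V UV; apply: sX.
split=> //; first exact: fpair_stable_biset.
rewrite (characteristic_normset pS gX (subxx S) onto_fully).
rewrite (card_normset gX sX' (subxx S)).
have cS : fcentric F S.
  apply: fully_normalized_fcentric fully_normalized_self _; exact: subsetIl.
have FSid : F S S id by apply: fusion_id.
have idM : morphic S id by case/fusion_mono: FSid.
have -> : mark X (twisted_diag S id) = #|'C_S(S)|.
  have le_mark := @card_cent_mark _ S X S id; rewrite imset_id in le_mark.
  apply/eqP; rewrite eqn_leq cX //= le_mark //.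
  apply: (pX (Group (twisted_diag_group_set idM))) => //.
  by apply/ftwistP; exists S, id.
have [m [p'm ->]] := fully_normalized_index fully_normalized_self.
by rewrite (setIidPl (normG S)) mulnK.
Qed.

(** The embedding of [L] in a staged biset bounds the mark from above. From below it suffices that
    the mark is nonzero, and already (S, id) fixes a point: otherwise N_L(S) would be empty and
    |L|/|S| divisible by [p]. *)
Lemma minimal_mark L P : minimal_characteristic_biset p F L -> fcentric F P ->
  mark L (twisted_diag P id) = #|'C_S(P)|.
Proof.
move=> [[gL sL chL] minL] cP; have sPS := cP.1.
have sDP : twisted_diag P id \subset H.
  by rewrite twisted_diag_sub imset_id sPS.
have [X stX] := exists_staged pS satF.
apply/eqP; rewrite eqn_leq; apply/andP; split.
  apply: leq_trans (embeds_mark sDP (minL X (staged_characteristic stX))) _.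
  by apply: (stg_centric stX) => //; apply: fusion_id.
have le_mark := @card_cent_mark _ S L P id; rewrite imset_id in le_mark.
rewrite le_mark //.
have: 0 < mark L (twisted_diag S id).
  move: chL; rewrite (characteristic_normset pS gL (subxx S) onto_fully).
  rewrite (card_normset gL (stable_fpair gL sL) (subxx S)) lt0n.
  by apply: contraNneq => ->; rewrite muln0 div0n dvdn0.
move/leq_trans; apply; apply/subset_leq_card/afixS.
by rewrite sub_twisted_diag sPS; apply/forall_inP.
Qed.

End MinimalBiset.

Section SubBisetMarks.

Variables (gT : finGroupType) (T U : {group gT}) (X : biset T) (Y : {set X}).
Hypothesis nYU : [acts setX U U, on Y | bact X].
Hypothesis sUT : U \subset T.

Local Notation SX := (sub_biset nYU sUT).

Lemma bstab_sub_biset (w : SX) : bstab w = bstab (val w) :&: setX U U.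
Proof.
have sH : setX U U \subset setX T T by apply: setXS.
apply/setP=> u; rewrite in_setI !mem_bstab.
case Uu: (u \in setX U U); rewrite ?andbF // (subsetP sH) //= andbT.
by rewrite -val_eqE /= (val_sub_bact nYU).
Qed.

Lemma mark_sub_biset (V : {set gT * gT}) : V \subset setX U U ->
  mark SX V = #|'Fix_(bact X)(V) :&: Y|.
Proof.
move=> sV; rewrite /mark -(card_imset _ val_inj); congr #|pred_of_set _|.
apply/setP=> w; apply/imsetP/setIP => [[z /afixP Fz ->] | [/afixP Fw Yw]].
  split; last exact: valP.
  by apply/afixP=> u Vu; rewrite -(val_sub_bact nYU) ?(subsetP sV) // -[in RHS](Fz u Vu).
exists (Sub w Yw); last by rewrite SubK.
apply/afixP=> u Vu; apply: val_inj.
by rewrite /= (val_sub_bact nYU) ?(subsetP sV) //= Fw.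
Qed.

Lemma card_sub_biset : #|SX| = #|Y|.
Proof. by rewrite card_sig; apply: eq_card => w; rewrite !inE. Qed.

End SubBisetMarks.

(** * Centralizers and normalizers in the minimal biset *)

Section Centralizer.

Variables (gT : finGroupType) (p : nat) (S : {group gT}) (F : fusion_system S).
Variables (P : {group gT}) (sPS : P \subset S) (L : biset S).
Hypotheses (pr_p : prime p) (pS : p.-group S) (satF : saturated p F).
Hypotheses (nP : fully_normalized F P) (sCP : 'C_S(P) \subset P).
Hypothesis minL : minimal_characteristic_biset p F L.

Local Notation Z := 'C_S(P)%G.
Local Notation CF := (centralizer_fusion F sPS).
Local Notation CL := (biset_centralizer L P).

Lemma centralizer_fusion_id Q R f : CF Q R f -> {in Q, f =1 id}.
Proof.
case/centralizer_homP=> sQZ _ _ [g [_ efg gP]] x Qx.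
by rewrite -efg // gP // (subsetP sCP) // (subsetP sQZ).
Qed.

Lemma mark_cent : mark L (twisted_diag P id) = #|'C_S(P)|.
Proof.
have cP := fully_normalized_fcentric satF nP sCP.
exact (minimal_mark pr_p pS satF minL cP).
Qed.

Lemma centset_bfix : biset_centset L P = bfix L P id.
Proof.
apply/setP=> w; have [gL _ _] := minL.1; have [Q [f [_ ew]]] := gL w.
exact: mem_centset ew sPS.
Qed.

Lemma centralizer_bfix (w : CL) : val w \in bfix L P id.
Proof.
have sub : biset_centset L P \subset bfix L P id by rewrite centset_bfix.
exact: (subsetP sub _ (valP w)).
Qed.

Lemma bstab_centralizer (w : CL) : bstab w = twisted_diag Z id.
Proof.
have [gL _ _] := minL.1; have [Q [f [_ ew]]] := gL (val w).
have := centralizer_bfix w; rewrite mem_fix; last first.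
  by rewrite twisted_diag_sub imset_id sPS.
rewrite ew sub_twisted_diag => /andP[sPQ /forall_inP ef].
have efZ x : x \in Z -> f x = x.
  by move=> Zx; apply/esym/eqP/ef/(subsetP sCP).
rewrite bstab_sub_biset ew; apply/setP=> -[b a].
rewrite in_setI !mem_twisted_diag inE /=.
apply/andP/andP => [[/andP[Qa /eqP ->] /andP[_ Za]] | [Za /eqP ->]].
  by rewrite Za efZ.
by rewrite Za efZ // eqxx (subsetP sPQ) // (subsetP sCP).
Qed.

(** C_L(P) is one orbit, whose stabilizer is the diagonal of C_S(P), and the morphisms of the
    centralizer system are inclusions. A characteristic [Y] has a point with that stabilizer,
    because N_Y(C_S(P)) cannot be empty. *)
Lemma minimal_characteristic_centralizer :
  minimal_characteristic_biset p CF CL.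
Proof.
have sZZ : 'C_S(P) \subset 'C_S(P) := subxx _.
have pZ : p.-group Z := pgroupS (subsetIl _ _) pS.
split.
  split.
  - move=> w; exists Z, id; split; first exact: fusion_id.
    exact: bstab_centralizer.
  - move=> Q fQ Q' R f h1 h2 sQ fM fI sfQ efQ /andP[C1 /eqP e1] /andP[C2 _].
    have h1E := centralizer_fusion_id C1; have h2E := centralizer_fusion_id C2.
    rewrite (eq_in_imset h1E) imset_id in e1; rewrite /bfix -e1.
    congr #|pred_of_set 'Fix_(_)(_)|; apply: eq_in_imset => x Qx.
    by rewrite /= h1E // h2E // efQ imset_f // -e1.
  rewrite card_sub_biset centset_bfix -/(mark L _) mark_cent divnn cardG_gt0.
  by rewrite dvdn1 neq_ltn prime_gt1 ?orbT.
move=> Y [gY _ chY]; apply: biset_embedding => [x | x x' _].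
  have nZ Q f : CF Q Z f -> Z \subset f @: Q -> Z \subset Q /\ f @: Z = Z.
    move=> Cf; have fE := centralizer_fusion_id Cf.
    rewrite (eq_in_imset fE) imset_id => sZQ; split=> //.
    by rewrite (eq_in_imset (g := id)) ?imset_id // => y /(subsetP sZQ)/fE.
  move: chY; rewrite (characteristic_normset pZ gY (subxx Z) nZ) => chY.
  have /card_gt0P[y Ny] : 0 < #|biset_normset Y Z|.
    by rewrite lt0n; apply: contraNneq chY => ->; rewrite div0n dvdn0.
  exists y; rewrite bstab_centralizer; have [Q [f [Cf ey]]] := gY y.
  move: Ny; rewrite (mem_normset _ ey) => /andP[sZQ _]; rewrite ey.
  have [sQZ _ _ _ _] := fusion_mono Cf.
  have -> : Q = Z by apply/group_inj/eqP; rewrite eqEsubset sQZ sZQ.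
  apply: eq_twisted_diag => z Zz; apply: (centralizer_fusion_id Cf).
  exact: (subsetP sZQ).
have sPid : id @: P \subset S by rewrite imset_id.
have le_mark : mark L (twisted_diag P id) <= #|'C_S(id @: P)|.
  by rewrite imset_id mark_cent.
have [c] := cent_transitive sPS sPid le_mark (centralizer_bfix x)
  (centralizer_bfix x').
rewrite imset_id => Zc ex'.
have Hc : (c, 1) \in setX Z Z by apply/mem_setXP; rewrite group1.
exists (c, 1) => //; apply: val_inj.
by rewrite ex' /= (val_sub_bact (acts_biset_centset L P)).
Qed.

End Centralizer.

(** * The normalizer *)

Section Normalizer.

Variables (gT : finGroupType) (p : nat) (S : {group gT}) (F : fusion_system S).
Variables (P : {group gT}) (sPS : P \subset S) (L : biset S).
Hypotheses (pr_p : prime p) (pS : p.-group S) (satF : saturated p F).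
Hypotheses (nP : fully_normalized F P) (sCP : 'C_S(P) \subset P).
Hypothesis minL : minimal_characteristic_biset p F L.

Local Notation T := 'N_S(P)%G.
Local Notation Z := 'C_S(P)%G.
Local Notation NF := (normalizer_fusion F sPS).
Local Notation NL := (biset_normalizer L P).

Let gL : biset_generated F L. Proof. by case: minL.1. Qed.
Let sL : fpair_stable F L. Proof. by case: minL.1 => _ s _; apply: stable_fpair. Qed.
Let cP : fcentric F P. Proof. exact (fully_normalized_fcentric satF nP sCP). Qed.
Let sPT : P \subset 'N_S(P). Proof. by rewrite subsetI sPS normG. Qed.
Let sTS : 'N_S(P) \subset S. Proof. exact: subsetIl. Qed.

Lemma normalizer_homI Q f : F Q S f -> P \subset Q -> Q \subset 'N_S(P) ->
  f @: P = P -> NF Q T f.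
Proof.
move=> Ff sPQ sQT fP; apply/normalizer_homP.
have sfQ : f @: Q \subset 'N_S(P).
  by have := fusion_norm_img Ff sPQ sQT; rewrite fP.
split=> //; first exact: fusion_cod Ff sfQ _.
exists f; split=> //.
have sQ : P <*> Q \subset Q by rewrite join_subG sPQ subxx.
have sT : P <*> T \subset S by rewrite join_subG sPS.
apply: (fusion_cod (fusion_res Ff sQ)) => //.
apply: subset_trans (imsetS f sQ) _; apply: subset_trans sfQ _.
exact: joing_subr.
Qed.

Lemma normalizer_hom_fix Q R f : NF Q R f -> P \subset Q -> f @: P = P.
Proof.
case/normalizer_homP=> _ _ _ [g [_ efg gP]] sPQ.
by rewrite -[RHS]gP; apply: eq_in_imset => x /(subsetP sPQ)/efg.
Qed.

Lemma normalizer_hom_onto Q f : NF Q T f -> P \subset f @: Q ->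
  P \subset Q /\ f @: P = P.
Proof.
move=> Nf; have := Nf; case/normalizer_homP=> _ _ _ [g [Fg efg gP]] sPfQ.
have [_ _ _ gI _] := fusion_mono Fg.
have sPQ : P \subset Q.
  apply/subsetP=> x Px.
  have : g x \in f @: Q by apply: (subsetP sPfQ); rewrite -gP imset_f.
  case/imsetP=> y Qy; rewrite -efg // => /gI -> //.
    by apply: (subsetP (joing_subl P Q)).
  by apply: (subsetP (joing_subr P Q)).
by split=> //; apply: normalizer_hom_fix Nf sPQ.
Qed.

Lemma Aut_normalizer_fusion : Aut_fusion NF P = Aut_fusion F P.
Proof.
apply/setP=> a; apply/setIdP/setIdP => -[AutA Fa]; split=> //.
  by case/normalizer_homP: Fa.
have aP : a @: P = P.
  apply/eqP; rewrite eqEcard card_imset ?leqnn ?andbT; last exact: perm_inj.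
  by case/fusion_mono: Fa.
have Na := normalizer_homI (fusion_widen Fa) (subxx P) sPT aP.
by apply: (fusion_cod Na); rewrite ?aP.
Qed.

(** Restricting the actions to N_S(P) cuts a stabilizer (Q, f) of [L] down to (N_Q(P), f), since [f]
    maps N_Q(P) into N_S(P). *)
Lemma bstab_normalizer (w : NL) : exists Q f,
  [/\ NF Q T f, P \subset Q, f @: P = P & bstab w = twisted_diag Q f].
Proof.
have [Q [f [Ff ew]]] := gL (val w).
have := valP w; rewrite /= (mem_normset P ew) => /andP[sPQ /eqP fP].
have sQ' : 'N_Q(P) \subset Q := subsetIl _ _.
have sQS : Q \subset S by case/fusion_mono: Ff.
have sPQ' : P \subset 'N_Q(P) by rewrite subsetI sPQ normG.
have sQ'T : 'N_Q(P) \subset 'N_S(P) by apply: setSI.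
have Nf : NF 'N_Q(P)%G T f by apply: normalizer_homI => //; apply: fusion_res Ff _.
exists 'N_Q(P)%G, f; split=> //.
rewrite bstab_sub_biset ew; apply/setP=> -[b a].
rewrite in_setI !mem_twisted_diag /=.
apply/andP/andP => [[/andP[Qa eb] /mem_setXP[_ /= /setIP[_ Na]]] | [Qa /eqP->]].
  by rewrite inE Qa.
rewrite (subsetP sQ') //=; split=> //; apply/mem_setXP; split=> /=.
  exact: fusion_sub Nf Qa.
exact: (subsetP sQ'T).
Qed.

Lemma generated_normalizer : biset_generated NF NL.
Proof. by move=> w; have [Q [f [? _ _ ?]]] := bstab_normalizer w; exists Q, f. Qed.

(** The points of N_L(P) fixed by [U] split, over [a] in Aut_F(P), into those fixed by <U, (P, a)>.
    The extensions of [f1] and [f2] restrict to automorphisms [b1] and [b2] of [P] and carry this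
    group to <V, (P, a')> with a' = [b1^-1 * a * b2]; stability of [L] and reindexing match the two
    sums. *)
Lemma stable_normalizer : fpair_stable NF NL.
Proof.
move=> U V /fpairP[A [B [f1 [f2 [N1 N2 sU eV]]]]].
have [sAT _ _ _ sf1] := fusion_mono N1; have [sBT _ _ _ sf2] := fusion_mono N2.
have sUT : U \subset setX 'N_S(P) 'N_S(P).
  exact: subset_trans sU (setXS sBT sAT).
have sVT : V \subset setX 'N_S(P) 'N_S(P).
  rewrite eV; apply/subsetP=> _ /imsetP[u /(subsetP sU)/mem_setXP[Bu Au] ->].
  by apply/mem_setXP; rewrite /= (fusion_sub N1) ?(fusion_sub N2).
have sTTS : setX 'N_S(P) 'N_S(P) \subset setX S S by apply: setXS.
rewrite !mark_sub_biset //= !(card_normsetI _ gL sPS).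
case/normalizer_homP: N1 => _ _ _ [g1 [G1 e1 g1P]].
case/normalizer_homP: N2 => _ _ _ [g2 [G2 e2 g2P]].
have toP g Q : F (P <*> Q)%G (P <*> T)%G g -> g @: P = P -> F P P g.
  move=> Fg gP; apply: (fusion_cod (fusion_res Fg (joing_subl P Q))) => //.
  by rewrite gP.
have [b1 A1 eb1] := fusion_Aut (toP _ _ G1 g1P).
have [b2 A2 eb2] := fusion_Aut (toP _ _ G2 g2P).
have bij : bijective (fun a => b1^-1 * a * b2).
  by exists (fun a => b1 * a * b2^-1) => a; rewrite !mulgA ?mulgK ?mulKVg ?mulgKV
     -?mulgA ?mulKg ?mulKVg ?mulgV ?mulVg ?mulg1.
rewrite [RHS](reindex _ (onW_bij _ bij)) /=; apply: eq_big => [a | a Aa].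
  pose AF := Aut_fusion_group F sPS.
  by rewrite -[LHS]/(a \in AF) -[RHS]/(_ \in AF) groupMr // groupMl ?groupV.
have [_ Fa] := setIdP Aa; have [_ _ aM _ sa] := fusion_mono Fa.
pose D := Group (twisted_diag_group_set aM).
have sD : D \subset setX S S by rewrite twisted_diag_sub sPS (subset_trans sa).
have sDP : D \subset setX P P by rewrite twisted_diag_sub subxx.
have sDBA : D \subset setX (P <*> B) (P <*> A).
  by apply: subset_trans sDP (setXS _ _); apply: joing_subl.
have sUBA : U \subset setX (P <*> B) (P <*> A).
  by apply: subset_trans sU (setXS _ _); apply: joing_subr.
have [_ _ gM1 _ _] := fusion_mono G1; have [_ _ gM2 _ _] := fusion_mono G2.
pose phi := pairm gM2 gM1.
have eV' : V = phi @* U :> {set _}.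
  rewrite morphimEsub // eV; apply: eq_in_imset => u.
  by case/(subsetP sU)/mem_setXP=> Bu Au; rewrite /= /pairf e1 ?e2.
have eD' : twisted_diag P (b1^-1 * a * b2) = phi @* D.
  rewrite morphimEsub //= (pairf_twisted_diag _ _ (g1 := b1^-1)); last first.
    by move=> x Px; rewrite -eb1 // permK.
  rewrite g1P; apply: eq_twisted_diag => x Px; rewrite /= !permM eb2 //.
  have PV : b1^-1 x \in P by apply: Aut_closed => //; rewrite groupV; case/setIdP: A1.
  by apply: (fusion_sub Fa).
rewrite /bfix -afixYin ?(subset_trans sUT) // eD'.
have sphiD : phi @* D \subset setX S S.
  rewrite -eD' twisted_diag_sub sPS /=; apply/subsetP=> _ /imsetP[x Px ->].
  have A12 : b1^-1 * a * b2 \in Aut_fusion_group F sPS by rewrite !groupM ?groupV.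
  by have [_ Fb] := setIdP A12; apply: (subsetP sPS); apply: (fusion_sub Fb).
rewrite eV' -afixYin ?sphiD //; last by rewrite -eV' (subset_trans sVT).
rewrite -morphimY //.
apply: (sL (U := [group of U <*> D]) (V := [group of phi @* (U <*> D)])).
have sUD : U <*> D \subset setX (P <*> B) (P <*> A) by rewrite join_subG sUBA.
apply/fpairP; exists (P <*> A)%G, (P <*> B)%G, g1, g2; split=> //.
- exact: fusion_widen G1.
- exact: fusion_widen G2.
by rewrite /= morphimEsub.
Qed.

(** The condition prime to [p] comes from |N_L(P)| = |Aut_F(P)| |C_S(P)| = m|N_S(P)|. *)
Lemma characteristic_normalizer : characteristic_biset p NF NL.
Proof.
split; first exact: generated_normalizer.
  exact: fpair_stable_biset stable_normalizer.
rewrite card_sub_biset (card_normset gL sL sPS) (minimal_mark pr_p pS satF minL cP).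
have [m [p'm ->]] := fully_normalized_index pr_p satF nP.
by rewrite mulnK.
Qed.

Lemma normalizer_transitive Q f (w w' : NL) : bstab w = twisted_diag Q f ->
    P \subset Q -> f @: P = P ->
    val w' \in bfix L P f ->
  exists2 c, c \in 'C_S(P) & val w' = bact L (val w) (c, 1).
Proof.
move=> ew sPQ fP Fw'.
have sPP : twisted_diag P f \subset setX S S by rewrite twisted_diag_sub fP sPS.
have Fw : val w \in bfix L P f.
  rewrite mem_fix //; have sw : bstab w \subset bstab (val w).
    by rewrite bstab_sub_biset subsetIl.
  apply: subset_trans sw; rewrite ew sub_twisted_diag sPQ.
  exact/forall_inP.
have FP : F P P f.
  have [R [r [Nr sPR rP er]]] := bstab_normalizer w.
  move: er; rewrite ew => /twisted_diag_inj[eQR efr].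
  have [_ _ Fr _] := normalizer_homP _ _ _ _ _ Nr.
  apply: (fusion_ext (f := r)); first by move=> x /(subsetP sPQ)/efr.
  by apply: (fusion_cod (fusion_res Fr sPR)); rewrite ?rP.
have [a Aa ea] := fusion_Aut FP.
have le_mark : mark L (twisted_diag P f) <= #|'C_S(f @: P)|.
  rewrite fP -(eq_twisted_diag ea) (mark_Aut sL Aa).
  by rewrite (minimal_mark pr_p pS satF minL cP).
have sfP : f @: P \subset S by rewrite fP.
have [c] := cent_transitive sPS sfP le_mark Fw Fw'.
by rewrite fP; exists c.
Qed.

(* p |Z| does not divide |Y^(P, f)|, so N(P, f) has an orbit on it whose length *)
(* is not divisible by p |Z|; as Z x 1 acts freely, this length is |Z|.        *)
Lemma normalizer_stab_exists (Y : biset 'N_S(P)%G) Q f :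
    characteristic_biset p NF Y -> NF Q T f -> P \subset Q -> f @: P = P ->
  exists2 y : Y, y \in bfix Y P f
    & 'N_(setX 'N_S(P) 'N_S(P))(twisted_diag P f) \subset
        bstab y * setX 'C_S(P) 1.
Proof.
move=> [gY sY chY] Nf sPQ fP; have sY' := stable_fpair gY sY.
have NfP : NF P P f by apply: (fusion_cod (fusion_res Nf sPQ)); rewrite ?fP.
have [a Aa ea] := fusion_Aut NfP.
have [_ _ fM _ _] := fusion_mono NfP.
have sZT : 'C_S(P) \subset 'N_S(P) by rewrite setIS // cent_sub.
have pT : p.-group T := pgroupS sTS pS.
have [m [p'm eqm]] := fully_normalized_index pr_p satF nP.
pose H := [group of setX 'N_S(P) 'N_S(P)].
pose D := Group (twisted_diag_group_set fM).
have sDH : D \subset H by rewrite twisted_diag_sub fP sPT.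
pose N := [group of 'N_H(D)]; pose Z1 := [group of setX Z [1 gT]].
have cZ1 : #|Z1| = #|'C_S(P)| by rewrite cardsX cards1 muln1.
have sNH : N \subset H := subsetIl _ _.
have sZ1N : Z1 \subset N.
  apply/subsetP=> -[c d] /mem_setXP[/= Zc /set1P->].
  apply/(norm_twisted_diagP _ _ _ fM); split; rewrite ?group1 //.
    have [Sc Cc] := setIP Zc; rewrite fP inE (subsetP sZT) //=.
    by rewrite (subsetP (cent_sub P)).
  move=> x Px; rewrite conjg1; apply/esym/conjg_fixP/commgP.
  have [_ Cc] := setIP Zc.
  by apply/commute_sym/(centP Cc); apply: fusion_sub NfP Px.
have nZ1N : N \subset 'N(Z1).
  apply/subsetP=> -[b a'] /(subsetP sNH)/mem_setXP[/= /setIP[Sb Nb] _].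
  rewrite inE; apply/subsetP=> _ /imsetP[[c d] /mem_setXP[/= Zc /set1P->] ->].
  have -> : (c, 1) ^ (b, a') = (c ^ b, 1 ^ a') by [].
  apply/mem_setXP; rewrite /= conj1g group1; split=> //.
  have [Sc Cc] := setIP Zc; rewrite inE groupJ //=.
  by rewrite memJ_norm // (subsetP (cent_norm P)).
have NactY : [acts N, on bfix Y P f | bact Y].
  have := acts_subnorm_fix (bact Y) D; rewrite (setIidPr sDH).
  exact: subset_trans.
have [y Fy ndvd] : exists2 y, y \in bfix Y P f
    & ~~ (p * #|'C_S(P)| %| #|orbit (bact Y) N y|).
  apply/exists_inP; apply: contraR chY; rewrite negb_exists_in => /forall_inP dvdO.
  (* If p|Z| divided all orbit lengths, it would divide the mark of (P, a), hence that of (P, id),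
     and |N_Y(P)| would be a multiple of p|N_S(P)|. *)
  have dvdY : p * #|'C_S(P)| %| mark Y (twisted_diag P id).
    have eqAut : mark Y (twisted_diag P a) = _ := mark_Aut sY' Aa.
    rewrite -eqAut (eq_twisted_diag ea) /mark -(acts_sum_card_orbit NactY).
    by apply: dvdn_sum => _ /imsetP[y Fy ->]; rewrite -[_ %| _]negbK dvdO.
  rewrite (characteristic_normset pT gY sPT normalizer_hom_onto).
  rewrite (card_normset gY sY' sPT) Aut_normalizer_fusion.
  have /dvdnP[k ->] := dvdY.
  have -> : (#|Aut_fusion F P| * (k * (p * #|'C_S(P)|)) = (k * p * m) * #|'N_S(P)|)%N.
    rewrite -[RHS]mulnA -eqm mulnCA -!mulnA; congr (_ * _)%N.
    by rewrite mulnCA.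
  by rewrite mulnK // -mulnA mulnCA dvdn_mulr.
exists y => //; set C := 'C_N[y | bact Y].
have sCN : C \subset N := subsetIl _ _.
have memC u : u \in C -> u \in bstab y.
  rewrite mem_subastab1 // => /andP[Nu eu].
  by rewrite mem_bstab eu (subsetP sNH u Nu).
have eM : [group of C] <*> Z1 = C * Z1 by rewrite norm_joinEl // (subset_trans sCN).
have sMN : [group of C] <*> Z1 \subset N by rewrite join_subG sCN.
(* [C] fixes [y] and [Z1] acts freely, so they meet trivially. The orbit length is thus |Z| times
   the index of the product in [N], a power of [p] that the choice of [y] forces to be 1. *)
have cM : #|[group of C] <*> Z1| = (#|C| * #|'C_S(P)|)%N.
  rewrite eM TI_cardMg ?cZ1 //; apply/trivgP/subsetP=> -[c d].
  case/setIP=> /memC Cc /mem_setXP[_ /= /set1P ed]; rewrite ed in Cc *.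
  by rewrite (bstab_l1 Cc) set11.
have eO : #|orbit (bact Y) N y| = (#|'C_S(P)| * #|N : [group of C] <*> Z1|)%N.
  rewrite card_orbit_in // -/C.
  apply/eqP; rewrite -(eqn_pmul2l (cardG_gt0 [group of C])) Lagrange //.
  by rewrite mulnA -cM Lagrange.
have pN : p.-group N.
  by apply: pgroupS sNH _; rewrite /pgroup cardsX pnatM -/(pgroup _ _) pT.
have idx1 : #|N : [group of C] <*> Z1| = 1%N.
  have: p.-nat #|N : [group of C] <*> Z1| by apply: pnat_dvd (dvdn_indexg N _) pN.
  case/p_natP=> // k ek; rewrite ek; case: k ek => // k ek; case/negP: ndvd.
  by rewrite eO ek mulnC dvdn_pmul2l // expnS dvdn_mulr.
have sNM : N \subset C * Z1 by rewrite -eM -indexg_eq1 idx1.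
apply: subset_trans sNM _; apply: mulSg; apply/subsetP=> u; exact: memC.
Qed.

(** For [w] with stabilizer (Q, f), the point [y] of [normalizer_stab_exists] has a stabilizer (R,
    r) with R = Q. Unique extension makes [r] and [f] conjugate by some [z] in C_S(P), and
    translating [y] by [z] gives the stabilizer (Q, f). *)
Lemma minimal_normalizer (Y : biset 'N_S(P)%G) :
  characteristic_biset p NF Y -> biset_embeds NL Y.
Proof.
move=> chY; have [gY _ _] := chY.
have sTTS : setX 'N_S(P) 'N_S(P) \subset setX S S by apply: setXS.
have sZT : 'C_S(P) \subset 'N_S(P) by rewrite setIS // cent_sub.
apply: biset_embedding => [w | w w' eww'].
  have [Q [f [Nf sPQ fP ew]]] := bstab_normalizer w.
  have [y Fy sN] := normalizer_stab_exists chY Nf sPQ fP.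
  have [sQT _ Ff _] := normalizer_homP _ _ _ _ _ Nf.
  have [_ _ fM fI sfT] := fusion_mono Nf.
  have fMP : morphic P f by case/fusion_mono: (fusion_res Nf sPQ).
  have sPT' : twisted_diag P f \subset setX 'N_S(P) 'N_S(P).
    by rewrite twisted_diag_sub fP sPT.
  have sPS' := subset_trans sPT' sTTS.
  have [R [r [Nr ey]]] := gY y.
  have [sRT _ Fr _] := normalizer_homP _ _ _ _ _ Nr.
  move: Fy; rewrite mem_fix // ey sub_twisted_diag => /andP[sPR /forall_inP efr].
  have norm_mem Q' g : NF Q' T g -> P \subset Q' -> {in P, g =1 f} ->
      forall x, x \in Q' -> (g x, x) \in 'N_(setX 'N_S(P) 'N_S(P))(twisted_diag P f).
    move=> Ng sPQ' egf x Qx; have [sQ'T _ _ _ sgT] := fusion_mono Ng.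
    have NSx : x \in 'N_S(P) := subsetP sQ'T x Qx.
    have NSgx : g x \in 'N_S(P) by apply/(subsetP sgT)/imset_f.
    have inNT u : u \in 'N_S(P) -> u \in 'N_('N_S(P))(P).
      by move=> NSu; rewrite inE NSu; case/setIP: NSu.
    apply/(norm_twisted_diagP _ _ _ fMP); split; rewrite ?fP ?inNT // => z Pz.
    rewrite -!egf ?memJ_norm //; last by case/setIP: NSx.
    by rewrite (fusionJ Ng) // (subsetP sPQ').
  (* Multiplication by C_S(P) x 1 does not affect the right coordinate, so each [x] in [Q] is the
     right coordinate of an element of the stabilizer of [y]. *)
  have sQR : Q \subset R.
    apply/subsetP=> x Qx.
    have := subsetP sN _ (norm_mem Q f Nf sPQ (fun _ _ => erefl) x Qx).
    case/mulsgP=> -[b a] [c d]; rewrite ey mem_twisted_diag /= => /andP[Ra _].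
    case/mem_setXP=> _ /= /set1P -> [_ ->].
    by rewrite mulg1.
  have efr' : {in P, r =1 f} by move=> x Px; apply/esym/eqP/efr.
  (* Conversely (r x, x) permutes the points of [L] fixed by (P, f), which form one orbit of C_S(P)
     x 1. Corrected by some (c, 1)^-1 it fixes [w], so [x] lies in [Q]. *)
  have sRQ : R \subset Q.
    apply/subsetP=> x Rx; have Nu := norm_mem R r Nr sPR efr' x Rx.
    have Hu := subsetP (subsetIl _ _) _ Nu.
    have Fw : val w \in bfix L P f.
      rewrite mem_fix //.
      have sw : bstab w \subset bstab (val w) by rewrite bstab_sub_biset subsetIl.
      apply: subset_trans sw; rewrite ew sub_twisted_diag sPQ.
      exact/forall_inP.
    have Fwu : val (bact NL w (r x, x)) \in bfix L P f.
      rewrite /= (val_sub_bact (acts_biset_normset L P)) //.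
      rewrite mem_fix // bstab_conj ?(subsetP sTTS) //.
      have [_ Nu'] := setIP Nu; rewrite -(normP Nu') conjSg.
      by move: Fw; rewrite mem_fix.
    have [c Zc ec] := normalizer_transitive ew sPQ fP Fwu.
    have Hc : (c, 1) \in setX 'N_S(P) 'N_S(P).
      by apply/mem_setXP; rewrite group1 (subsetP sZT).
    have: (r x, x) * (c, 1)^-1 \in bstab w.
      rewrite mem_bstab groupM ?groupV // andTb bact_mul ?groupV //.
      apply/eqP/val_inj; rewrite /= (val_sub_bact (acts_biset_normset L P)) ?groupV //.
      rewrite ec -bact_mul ?groupV ?(subsetP sTTS) // mulgV; exact: bact1.
    rewrite ew mem_twisted_diag => /andP[+ _].
    have -> : ((r x, x) * (c, 1)^-1).2 = x * 1^-1 by [].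
    by rewrite invg1 mulg1.
  have eRQ : R = Q by apply/group_inj/eqP; rewrite eqEsubset sRQ.
  rewrite eRQ in Nr Fr ey.
  have FrS : F Q S r := fusion_widen Fr.
  have FfS : F Q S f := fusion_widen Ff.
  have [z] := fusion_unique_extension pS satF cP sPQ sQT FfS FrS efr'.
  rewrite fP => Zz ez.
  have Hz : (z, 1) \in setX 'N_S(P) 'N_S(P).
    by apply/mem_setXP; rewrite group1 (subsetP sZT).
  exists (bact Y y (z, 1)^-1); rewrite bstab_conj ?groupV // ew ey.
  apply/esym; rewrite /twisted_diag; apply/setP=> u; rewrite mem_conjgV.
  apply/imsetP/imsetP => [[x Qx ->] | [x Qx]].
    exists x => //; have -> : (f x, x) ^ (z, 1) = (f x ^ z, x ^ 1) by [].
    by rewrite conjg1 ez.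
  move=> eu; exists x => //; apply: (conjg_inj (z, 1)); rewrite eu.
  have -> : (f x, x) ^ (z, 1) = (f x ^ z, x ^ 1) by [].
  by rewrite conjg1 ez.
(* Equal stabilizers contain the same (P, f), whose fixed points in [L] form a single orbit of
   C_S(P) x 1. *)
have [Q [f [Nf sPQ fP ew]]] := bstab_normalizer w.
have Fw' : val w' \in bfix L P f.
  rewrite mem_fix; last by rewrite twisted_diag_sub fP sPS.
  have sw : bstab w' \subset bstab (val w') by rewrite bstab_sub_biset subsetIl.
  apply: subset_trans sw; rewrite -eww' ew sub_twisted_diag sPQ.
  exact/forall_inP.
have [c Zc ec] := normalizer_transitive ew sPQ fP Fw'.
have Hc : (c, 1) \in setX 'N_S(P) 'N_S(P).
  by apply/mem_setXP; rewrite group1 (subsetP sZT).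
exists (c, 1) => //; apply: val_inj.
by rewrite ec /= (val_sub_bact (acts_biset_normset L P)).
Qed.

End Normalizer.

Theorem theoremE (gT : finGroupType) (p : nat) (S : {group gT})
    (F : fusion_system S) (P : {group gT}) (sPS : P \subset S)
    (Lambda : biset S) :
  prime p -> p.-group S -> saturated p F ->
  fully_normalized F P -> 'C_S(P) \subset P ->
  minimal_characteristic_biset p F Lambda ->
  let CF := centralizer_fusion F sPS in
  let NF := normalizer_fusion F sPS in
  let CLambda := biset_centralizer Lambda P in
  let NLambda := biset_normalizer Lambda P in
  [/\ minimal_characteristic_biset p CF CLambda,
      forall LambdaC : biset 'C_S(P)%G,
        minimal_characteristic_biset p CF LambdaC ->
        biset_isog CLambda LambdaC,
      minimal_characteristic_biset p NF NLambda
    & forall LambdaN : biset 'N_S(P)%G,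
        minimal_characteristic_biset p NF LambdaN ->
        biset_isog NLambda LambdaN].
Proof.
move=> pr_p pS satF nP sCP minL CF NF CL NL.
have minCL : minimal_characteristic_biset p CF CL.
  exact: minimal_characteristic_centralizer.
have minNL : minimal_characteristic_biset p NF NL.
  split; first exact: characteristic_normalizer.
  exact: minimal_normalizer.
by split=> // M minM; apply: minimal_unique minM.
Qed.
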